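(* Let $G$ be a non-discrete LCA group with dual $\Gamma$, $V$ an open neighbourhood of $0\in\Gamma$ with compact closure $\bar V$, $\mu$ a positive unbounded Radon measure on $\Gamma$ and $1\le p<\infty$. Then $\mathcal A_{p,\mu}(\Gamma):=\{\psi\in\mathcal A(\Gamma):\psi\in L^p(\mu)\}$ with the norm $\|\psi\|_{\mathcal A_{p,\mu}}:=\|\psi\|^{\bar V}+\|\psi\|_{L^p(\mu)}$ is a Segal algebra in $\mathcal A(\Gamma)$.
   Context: $G$ non-discrete LCA with dual $\Gamma$, $(x,\gamma)=\gamma(x)$. For $E\subseteq\Gamma$, $\mathrm{span}(E)$ is the span of the characters in $E$ as functions on $G$, each $p=\sum\hat p(\gamma)\gamma$ uniquely, $\|p\|_\infty=\sup_G|p|$. For $\phi\in C_b(\Gamma)$: $\|\phi\|^{\bar V,\gamma}=\sup\{|\sum_{\gamma'\in\bar V+\gamma}\hat p(\gamma')\phi(\gamma')|:p\in\mathrm{span}(\bar V+\gamma),\|p\|_\infty\le1\}$, $\|\phi\|^{\bar V}=\sup_\gamma\|\phi\|^{\bar V,\gamma}$, $C^{\bar V}_{BSE}(\Gamma)=\{\phi\in C_b(\Gamma):\|\phi\|^{\bar V}<\infty\}$. With $\mathcal K(\Gamma)$ the compact subsets of $\Gamma$ with dense nonempty interior directed by inclusion, $\mathcal A(\Gamma)=\{\psi\in C^{\bar V}_{BSE}(\Gamma):\lim_{\Omega\in\mathcal K(\Gamma)}\sup_{\gamma\notin\Omega}\|\psi\|^{\bar V,\gamma}=0\}$, a commutative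 Banach function algebra under $\|\cdot\|^{\bar V}$. A Segal algebra in $\mathcal A(\Gamma)$ is a dense ideal $\mathcal S$ that is a Banach space under a norm $\|\cdot\|_{\mathcal S}\ge\|\cdot\|^{\bar V}$, with $\|\phi\psi\|_{\mathcal S}\le\|\phi\|_{\mathcal S}\|\psi\|^{\bar V}$ ($\phi\in\mathcal S,\psi\in\mathcal A(\Gamma)$), and having approximate units (for each $\phi\in\mathcal S$, $\varepsilon>0$ some $u\in\mathcal S$ has $\|\phi-u\phi\|_{\mathcal S}<\varepsilon$). *)

(* Defs.v *)
From HB Require Import structures.
From mathcomp Require Import all_boot all_order all_algebra.
From mathcomp Require Import all_classical all_reals all_analysis.
From mathcomp Require Import complex.

Set Implicit Arguments.
Unset Strict Implicit.
Unset Printing Implicit Defensive.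

Import Order.TTheory GRing.Theory Num.Theory.
Local Open Scope classical_set_scope.
Local Open Scope ring_scope.

(* Borel sigma-algebra of a topological abelian group (the carrier is given a point,
   0, only because the library's generated sigma-algebra construction asks for one). *)
Definition ptd (T : topologicalZmodType) : Type := T.
HB.instance Definition _ (T : topologicalZmodType) := Choice.on (ptd T).
HB.instance Definition _ (T : topologicalZmodType) := isPointed.Build (ptd T) 0%R.
Notation Borel T := (g_sigma_algebraType (@open T : set (set (ptd T)))).

Section LCA_BSE.
Variable R : realType.

Definition cabs (z : R[i]) : R := ComplexField.Normc.normc z.

Definition ccontinuous (T : topologicalType) (f : T -> R[i]) : Prop :=
  forall (x : T) (e : R), 0 < e -> \forall y \near x, cabs (f y - f x) < e.

Definition is_character (G : topologicalZmodType) (f : G -> R[i]) : Prop :=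
  [/\ forall x, cabs (f x) = 1,
      forall x y, f (x + y) = f x * f y &
      ccontinuous f].

Definition nondiscrete_LCA (G : topologicalZmodType) : Prop :=
  [/\ hausdorff_space G, locally_compact [set: G] & ~ (forall A : set G, open A)].

(* Gamma, with pairing chi x gamma = (x, gamma), is (isomorphic as a topological
   group to) the Pontryagin dual of G: gamma |-> chi(., gamma) is a group isomorphism
   of Gamma onto the group of continuous characters of G and the topology of Gamma is
   the compact-open topology (uniform convergence on compact subsets of G). *)
Definition is_dual_pairing (G Gamma : topologicalZmodType) (chi : G -> Gamma -> R[i]) : Prop :=
  [/\ forall g : Gamma, is_character (chi^~ g),
      forall (x : G) (g1 g2 : Gamma), chi x (g1 + g2) = chi x g1 * chi x g2,
      forall g1 g2 : Gamma, (forall x, chi x g1 = chi x g2) -> g1 = g2,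
      forall f : G -> R[i], is_character f -> exists g : Gamma, forall x, chi x g = f x &
      forall (g0 : Gamma) (A : set Gamma),
        nbhs g0 A <->
        exists (K : set G) (e : R), [/\ compact K, 0 < e &
          [set g | forall x, K x -> cabs (chi x g - chi x g0) < e] `<=` A]].

Definition translate (Gamma : zmodType) (E : set Gamma) (g : Gamma) : set Gamma :=
  [set v + g | v in E].

Definition trigpoly (G Gamma : topologicalZmodType) (chi : G -> Gamma -> R[i])
  (s : seq Gamma) (c : Gamma -> R[i]) : G -> R[i] :=
  fun x => \sum_(g <- s) c g * chi x g.

Definition bse_loc (G Gamma : topologicalZmodType) (chi : G -> Gamma -> R[i])
  (E : set Gamma) (phi : Gamma -> R[i]) : \bar R :=
  ereal_sup [set r : \bar R | exists (s : seq Gamma) (c : Gamma -> R[i]),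
    [/\ uniq s, (forall g, g \in s -> E g),
        (forall x : G, cabs (trigpoly chi s c x) <= 1) &
        r = (cabs (\sum_(g <- s) c g * phi g))%:E]].

Definition bse_norm_at (G Gamma : topologicalZmodType) (chi : G -> Gamma -> R[i])
  (V : set Gamma) (g : Gamma) (phi : Gamma -> R[i]) : \bar R :=
  bse_loc chi (translate (closure V) g) phi.

Definition bse_norm (G Gamma : topologicalZmodType) (chi : G -> Gamma -> R[i])
  (V : set Gamma) (phi : Gamma -> R[i]) : \bar R :=
  ereal_sup [set bse_norm_at chi V g phi | g in [set: Gamma]].

Definition Cb (Gamma : topologicalType) : set (Gamma -> R[i]) :=
  [set phi | ccontinuous phi /\ exists M : R, forall g, cabs (phi g) <= M].

Definition C_BSE (G Gamma : topologicalZmodType) (chi : G -> Gamma -> R[i])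
  (V : set Gamma) : set (Gamma -> R[i]) :=
  [set phi | Cb phi /\ (bse_norm chi V phi < +oo)%E].

Definition Kdir (Gamma : topologicalType) : set (set Gamma) :=
  [set O | [/\ compact O, O° !=set0 & O `<=` closure (O°)]].

Definition A_alg (G Gamma : topologicalZmodType) (chi : G -> Gamma -> R[i])
  (V : set Gamma) : set (Gamma -> R[i]) :=
  [set psi | C_BSE chi V psi /\
    forall e : R, 0 < e -> exists2 O0, Kdir O0 &
      forall O, Kdir O -> O0 `<=` O ->
        (ereal_sup [set bse_norm_at chi V g psi | g in ~` O] <= e%:E)%E].

Definition fadd (T : Type) (f h : T -> R[i]) : T -> R[i] := fun g => f g + h g.
Definition fsub (T : Type) (f h : T -> R[i]) : T -> R[i] := fun g => f g - h g.
Definition fmul (T : Type) (f h : T -> R[i]) : T -> R[i] := fun g => f g * h g.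
Definition fscale (T : Type) (a : R[i]) (f : T -> R[i]) : T -> R[i] := fun g => a * f g.

Definition segal_algebra (Gamma : Type) (A : set (Gamma -> R[i]))
  (NA : (Gamma -> R[i]) -> \bar R)
  (S : set (Gamma -> R[i])) (NS : (Gamma -> R[i]) -> \bar R) : Prop :=
  [/\
    [/\ S `<=` A,
        forall f1 f2, S f1 -> S f2 -> S (fadd f1 f2),
        forall (a : R[i]) f, S f -> S (fscale a f) &
        forall f h, S f -> A h -> S (fmul f h)],
    (forall h, A h -> forall e : R, 0 < e ->
        exists2 f, S f & (NA (fsub h f) < e%:E)%E),
    [/\ forall f, S f -> NS f \is a fin_num,
        forall f, S f -> NS f = 0%E -> f = (fun _ => 0),
        forall (a : R[i]) f, S f -> NS (fscale a f) = ((cabs a)%:E * NS f)%E,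
        forall f1 f2, S f1 -> S f2 ->
           (NS (fadd f1 f2) <= NS f1 + NS f2)%E &
        forall u : nat -> Gamma -> R[i], (forall n, S (u n)) ->
          (forall e : R, 0 < e -> exists N, forall m n, (N <= m)%N -> (N <= n)%N ->
             (NS (fsub (u m) (u n)) < e%:E)%E) ->
          exists2 f, S f & forall e : R, 0 < e -> exists N, forall n, (N <= n)%N ->
             (NS (fsub (u n) f) < e%:E)%E],
    [/\ forall f, S f -> (NA f <= NS f)%E &
        forall f h, S f -> A h -> (NS (fmul f h) <= NS f * NA h)%E] &
    forall f, S f -> forall e : R, 0 < e ->
      exists2 u, S u & (NS (fsub f (fmul u f)) < e%:E)%E ].

Definition radon (T : topologicalZmodType) (mu : {measure set (Borel T) -> \bar R}) : Prop :=
  [/\ forall K : set T, compact K -> (mu K < +oo)%E,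
      forall A : set T, measurable (A : set (Borel T)) ->
        mu A = ereal_inf [set mu U | U in [set U : set T | open U /\ A `<=` U]] &
      forall U : set T, open U ->
        mu U = ereal_sup [set mu K | K in [set K : set T | compact K /\ K `<=` U]]].

Definition Lp_norm (T : topologicalZmodType) (mu : {measure set (Borel T) -> \bar R})
  (p : R) (f : T -> R[i]) : \bar R :=
  Lnorm mu p%:E (fun x : Borel T => (cabs (f x))%:E).

End LCA_BSE.

(* Main.v *)
Require Import Defs.
From HB Require Import structures.
From mathcomp Require Import all_boot all_order all_algebra.
From mathcomp Require Import all_classical all_reals all_analysis.
From mathcomp Require Import measurable_realfun complex ring lra.

(** The point is to find compactly supported [u] in A(Gamma), equal to 1 on a given compact
    set, with [||u||] bounded independently of that set; no Haar measure is needed, because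
    the norm only tests functions on translates of the closure of V.
    - A function F built from finitely many characters [chi x] of Gamma by sums, products and
      [|Re|] has finite norm (each character has norm 1), equals 1 near 0, and vanishes on
      [U \ V], where U is a large compact neighbourhood of the closure of V.  Cutting F off
      outside V gives a bump r: every translate of the closure of V misses V or lies in U,
      so r is there equal to 0 or to F.
    - If the points a form a separated net of a compact set, [u = 1 - prod_a (1 - r(. - a))]
      is 1 on that set, and on each translate of the closure of V a bounded number of factors
      differs from 1, so the norm of u is bounded uniformly.
    Then [u f] approximates f in the norm of A(Gamma), because f decays at infinity, and
    in L^p by dominated convergence.  Completeness in L^p is Fatou's lemma. *)

Set Implicit Arguments.
Unset Strict Implicit.
Unset Printing Implicit Defensive.

Import Order.TTheory GRing.Theory Num.Theory.
Import numFieldNormedType.Exports.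
Local Open Scope classical_set_scope.
Local Open Scope ring_scope.

(** * Multipliers of trigonometric polynomials *)


Section complex_modulus.
Variable R : realType.
Implicit Types (z w : R[i]) (a : R).

Lemma cabs_ge0 z : 0 <= cabs z.
Proof. by case: z => a b; exact: sqrtr_ge0. Qed.

Lemma cabs0 : cabs (0 : R[i]) = 0. Proof. exact: ComplexField.Normc.normc0. Qed.

Lemma cabs1 : cabs (1 : R[i]) = 1. Proof. exact: ComplexField.Normc.normc1. Qed.

Lemma cabsM z w : cabs (z * w) = cabs z * cabs w.
Proof. exact: ComplexField.Normc.normcM. Qed.

Lemma cabsN z : cabs (- z) = cabs z. Proof. exact: normcN. Qed.

Lemma cabsD z w : cabs (z + w) <= cabs z + cabs w. Proof. exact: le_normcD. Qed.

Lemma cabsB z w : cabs (z - w) = cabs (w - z).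
Proof. by rewrite -cabsN opprB. Qed.

Lemma cabs_eq0 z : cabs z = 0 -> z = 0.
Proof. exact: ComplexField.Normc.eq0_normc. Qed.

Lemma cabs_real a : cabs a%:C%C = `|a|.
Proof. by rewrite /cabs /= expr0n /= addr0 sqrtr_sqr. Qed.

Lemma sqr_cabs z : cabs z ^+ 2 = complex.Re z ^+ 2 + complex.Im z ^+ 2.
Proof. by case: z => a b; rewrite sqr_sqrtr // addr_ge0 // sqr_ge0. Qed.

Lemma cabs_conj z : cabs (conjc z) = cabs z.
Proof. by case: z => a b; rewrite /cabs /= sqrrN. Qed.

Lemma normr_Re z : `|complex.Re z| <= cabs z.
Proof.
rewrite -(@ler_pXn2r _ 2) // ?nnegrE ?cabs_ge0 //.
by rewrite sqr_cabs real_normK ?num_real // lerDl sqr_ge0.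
Qed.

Lemma normr_Im z : `|complex.Im z| <= cabs z.
Proof.
rewrite -(@ler_pXn2r _ 2) // ?nnegrE ?cabs_ge0 //.
by rewrite sqr_cabs real_normK ?num_real // lerDr sqr_ge0.
Qed.

Lemma cabs_le_ReIm z : cabs z <= `|complex.Re z| + `|complex.Im z|.
Proof.
rewrite -(@ler_pXn2r _ 2) // ?nnegrE ?cabs_ge0 ?addr_ge0 //.
rewrite sqr_cabs sqrrD !real_normK ?num_real // lerD2r lerDl.
by rewrite mulrn_wge0 ?mulr_ge0.
Qed.

Lemma cabs_distD z w : `|cabs z - cabs w| <= cabs (z - w).
Proof.
rewrite ler_norml; apply/andP; split.
  by rewrite lerNl opprB lerBlDr -[X in cabs X <= _](subrK z) cabsB cabsD.
by rewrite lerBlDr -[X in cabs X <= _](subrK w) cabsD.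
Qed.

End complex_modulus.

Section multiplier_bounds.
Variables (R : realType) (G Gamma : topologicalZmodType).
Variable chi : G -> Gamma -> R[i].
Implicit Types (E : set Gamma) (phi psi : Gamma -> R[i]) (M N : R).

(** The functional that pairs [phi] with the coefficients of a polynomial with frequencies in [E]
    has norm at most [M]. Inequalities with a real bound keep the calculus of norms out of the
    extended reals. *)
Definition mult_bound E phi M : Prop := (bse_loc chi E phi <= M%:E)%E.

Lemma trigpolyZ s c (a : R[i]) x :
  trigpoly chi s (fun g => a * c g) x = a * trigpoly chi s c x.
Proof. by rewrite /trigpoly big_distrr /=; apply: eq_bigr => g _; rewrite mulrA. Qed.

Lemma trigpoly_bound_ge0 s c K : (forall x, cabs (trigpoly chi s c x) <= K) -> 0 <= K.
Proof. by move=> /(_ 0); exact: le_trans (cabs_ge0 _). Qed.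

(** By homogeneity, tests bounded by 1 can be replaced by tests bounded by any [K]. Division by [K]
    fails only for [K = 0], where all multiples of the polynomial remain admissible and force the
    sum to vanish. *)
Lemma mult_boundP E phi M : mult_bound E phi M <->
  forall (s : seq Gamma) (c : Gamma -> R[i]) (K : R),
  uniq s -> (forall g, g \in s -> E g) ->
  (forall x, cabs (trigpoly chi s c x) <= K) ->
  cabs (\sum_(g <- s) c g * phi g) <= M * K.
Proof.
split=> [h s c K us sE cK|h]; last first.
  apply: ge_ereal_sup => _ [s [c [us sE c1 ->]]].
  by rewrite lee_fin -[M]mulr1; exact: h.
have h1 (d : Gamma -> R[i]) : (forall x, cabs (trigpoly chi s d x) <= 1) ->
    cabs (\sum_(g <- s) d g * phi g) <= M.
  move=> d1; rewrite -lee_fin; apply: le_trans h.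
  by apply: ereal_sup_ubound; exists s, d.
have hZ (t : R) : 0 <= t -> t * K <= 1 -> t * cabs (\sum_(g <- s) c g * phi g) <= M.
  move=> t0 tK; have := h1 (fun g => t%:C%C * c g).
  under eq_bigr do rewrite -mulrA; rewrite -big_distrr /= cabsM cabs_real ger0_norm //.
  apply=> x; rewrite trigpolyZ cabsM cabs_real ger0_norm //.
  by apply: le_trans tK; rewrite ler_wpM2l.
have K0 := trigpoly_bound_ge0 cK; move: K0; rewrite le_eqVlt => /orP[/eqP K0|K0].
  rewrite -K0 mulr0 leNgt; apply/negP => S0.
  have M0 : 0 <= M by have := hZ 0; rewrite !mul0r ler01; exact.
  (* This factor would raise the value of the functional to [M + 1], beyond its bound [M]. *)
  have := hZ ((M + 1) / cabs (\sum_(g <- s) c g * phi g)).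
  rewrite -K0 mulr0 ler01 mulfVK ?gt_eqF // divr_ge0 ?cabs_ge0 ?addr_ge0 //.
  by move=> /(_ isT isT); rewrite gerDl ler10.
rewrite -ler_pdivrMr // mulrC; apply: hZ; first by rewrite invr_ge0 ltW.
by rewrite mulVf // gt_eqF.
Qed.

Lemma eq_mult_bound E phi psi M :
  mult_bound E phi M -> (forall g, E g -> phi g = psi g) -> mult_bound E psi M.
Proof.
move=> /mult_boundP h e; apply/mult_boundP => s c K us sE cK.
rewrite (_ : \sum_(g <- s) c g * psi g = \sum_(g <- s) c g * phi g); first exact: h.
by apply: eq_big_seq => g /sE Eg; rewrite e.
Qed.

Lemma sub_mult_bound E E' phi M :
  E' `<=` E -> mult_bound E phi M -> mult_bound E' phi M.
Proof.
by move=> sE /mult_boundP h; apply/mult_boundP => s c K us sE'; apply: h => // g /sE' /sE.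
Qed.

Lemma le_mult_bound E phi M N : M <= N -> mult_bound E phi M -> mult_bound E phi N.
Proof.
by move=> MN h; apply: le_trans h _; rewrite lee_fin.
Qed.

Lemma mult_bound0 E : mult_bound E (fun=> 0) 0.
Proof.
apply/mult_boundP => s c K _ _ _; rewrite big1 ?cabs0 ?mul0r // => g _; exact: mulr0.
Qed.

Lemma mult_boundD E phi psi M N : mult_bound E phi M -> mult_bound E psi N ->
  mult_bound E (fun g => phi g + psi g) (M + N).
Proof.
move=> /mult_boundP hM /mult_boundP hN; apply/mult_boundP => s c K us sE cK.
under eq_bigr do rewrite mulrDr.
rewrite big_split /= mulrDl; apply: le_trans (cabsD _ _) _.
by apply: lerD; [exact: hM|exact: hN].
Qed.

Lemma mult_boundZ E phi M (a : R[i]) : mult_bound E phi M ->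
  mult_bound E (fun g => a * phi g) (cabs a * M).
Proof.
move=> /mult_boundP hM; apply/mult_boundP => s c K us sE cK; under eq_bigr do rewrite mulrCA.
rewrite -big_distrr /= cabsM -mulrA ler_wpM2l ?cabs_ge0 //; exact: hM.
Qed.

Lemma mult_boundN E phi M : mult_bound E phi M ->
  mult_bound E (fun g => - phi g) M.
Proof.
move=> /(@mult_boundZ _ _ _ (-1)); rewrite cabsN cabs1 mul1r => h.
by apply: (eq_mult_bound h) => g _; rewrite mulN1r.
Qed.

Lemma mult_boundB E phi psi M N : mult_bound E phi M -> mult_bound E psi N ->
  mult_bound E (fun g => phi g - psi g) (M + N).
Proof. by move=> hM /mult_boundN; exact: mult_boundD. Qed.

(** A single test involves only finitely many frequencies, so pointwise convergence on [E] passes to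
    the sums and the bound survives in the limit. *)
Lemma mult_bound_lim E (phi : nat -> Gamma -> R[i]) psi M :
  (forall n, mult_bound E (phi n) M) ->
  (forall g, E g -> forall e, 0 < e ->
     exists n0, forall n, (n0 <= n)%N -> cabs (phi n g - psi g) < e) ->
  mult_bound E psi M.
Proof.
move=> h cvg; apply/mult_boundP => s c K us sE cK; apply/ler_addgt0Pr => e e0.
have cv : exists n0, forall n, (n0 <= n)%N ->
    cabs (\sum_(g <- s) c g * phi n g - \sum_(g <- s) c g * psi g) < e.
  elim: s sE e e0 {us cK} => [_ e e0|g s IH sE e e0].
    by exists 0%N => n _; rewrite !big_nil subr0 cabs0.
  have e2 : 0 < e / 2 by rewrite divr_gt0.
  have [|N1 hN1] := IH _ _ e2.
    by move=> k ks; apply: sE; rewrite in_cons ks orbT.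
  (* Adding 1 keeps the divisor positive when the coefficient vanishes. *)
  have c0 : 0 < cabs (c g) + 1 by rewrite ltr_wpDl ?cabs_ge0.
  have [N2 hN2] := cvg g (sE g (mem_head _ _)) _ (divr_gt0 e2 c0).
  exists (maxn N1 N2) => n; rewrite geq_max => /andP[n1 n2].
  rewrite !big_cons opprD addrACA -mulrBr (splitr e).
  apply: le_lt_trans (cabsD _ _) _; apply: ltr_leD; last exact/ltW/hN1.
  rewrite cabsM; apply: (@le_lt_trans _ _ ((cabs (c g) + 1) * cabs (phi n g - psi g))).
    by rewrite ler_wpM2r ?cabs_ge0 // lerDl.
  by rewrite mulrC -ltr_pdivlMr //; exact: hN2.
have [n /(_ n (leqnn n)) hn] := cv.
rewrite -[X in cabs X](subrK (\sum_(g <- s) c g * phi n g)).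
apply: le_trans (cabsD _ _) _; rewrite addrC lerD //; first by have /mult_boundP := h n; exact.
by rewrite cabsB ltW.
Qed.

End multiplier_bounds.

Section dual_pairing.
Variables (R : realType) (G Gamma : topologicalZmodType).
Variable chi : G -> Gamma -> R[i].
Hypothesis dual : is_dual_pairing chi.
Implicit Types (E : set Gamma) (phi psi : Gamma -> R[i]) (M N : R).

Lemma cabs_chi x g : cabs (chi x g) = 1.
Proof. by case: dual => + _ _ _ _ => /(_ g) []. Qed.

Lemma chiDl x y g : chi (x + y) g = chi x g * chi y g.
Proof. by case: dual => + _ _ _ _ => /(_ g) []. Qed.

Lemma chiDr x g h : chi x (g + h) = chi x g * chi x h.
Proof. by case: dual. Qed.

Lemma chi_inj g h : (forall x, chi x g = chi x h) -> g = h.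
Proof. by case: dual => _ _ + _ _; exact. Qed.

Lemma chi_neq0 x g : chi x g != 0.
Proof.
by apply/eqP => e; have := cabs_chi x g; rewrite e cabs0 => /eqP; rewrite eq_sym oner_eq0.
Qed.

Lemma chi0 x : chi x 0 = 1.
Proof. by apply: (mulfI (chi_neq0 x 0)); rewrite -chiDr addr0 mulr1. Qed.

Lemma chi0l g : chi 0 g = 1.
Proof. by apply: (mulfI (chi_neq0 0 g)); rewrite -chiDl addr0 mulr1. Qed.

Lemma chiNl x g : chi (- x) g = conjc (chi x g).
Proof.
apply: (mulfI (chi_neq0 x g)); rewrite -chiDl subrr chi0l.
have := sqr_cabs (chi x g); rewrite cabs_chi expr1n; case: (chi x g) => a b /= h.
apply/eqP; rewrite eq_complex /=; apply/andP; split; apply/eqP; last by ring.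
by rewrite {1}h; ring.
Qed.

(** Moving [psi] into the coefficients leaves a test for [phi]. Its value at [x] is the functional
    of [psi] applied to the translate of the original polynomial by [x], which is still bounded by
    [K]; so the new test is bounded by [N * K]. *)
Lemma mult_boundM E phi psi M N : mult_bound chi E phi M -> mult_bound chi E psi N ->
  mult_bound chi E (fun g => phi g * psi g) (M * N).
Proof.
move=> /mult_boundP hM /mult_boundP hN; apply/mult_boundP => s c K us sE cK.
rewrite -mulrA (eq_bigr (fun g => c g * psi g * phi g)) => [|g _]; last by ring.
apply: hM => // x; rewrite /trigpoly.
rewrite (eq_bigr (fun g => c g * chi x g * psi g)) => [|g _]; last by ring.
apply: hN => // y; have := cK (x + y); rewrite /trigpoly.
by congr (cabs _ <= _); apply: eq_bigr => g _; rewrite chiDl mulrA.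
Qed.

(** Pairing with [chi x] is evaluation of the polynomial at [x]. *)
Lemma mult_bound_chi E x : mult_bound chi E (chi x) 1.
Proof. by apply/mult_boundP => s c K us sE /(_ x); rewrite mul1r. Qed.

Lemma mult_bound1 E : mult_bound chi E (fun=> 1) 1.
Proof.
by apply: (eq_mult_bound (mult_bound_chi E 0)) => g _; exact: chi0l.
Qed.

Lemma mult_bound_cst E (a : R[i]) : mult_bound chi E (fun=> a) (cabs a).
Proof.
by have := mult_boundZ a (mult_bound1 E); rewrite !mulr1.
Qed.

Lemma mult_bound_prod E (I : Type) (s : seq I) (phi : I -> Gamma -> R[i]) (M : I -> R) :
  (forall i, mult_bound chi E (phi i) (M i)) ->
  mult_bound chi E (fun g => \prod_(i <- s) phi i g) (\prod_(i <- s) M i).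
Proof.
move=> h; elim: s => [|i s IH].
  rewrite big_nil; apply: (eq_mult_bound (mult_bound1 E)) => g _.
  by rewrite big_nil.
rewrite big_cons; apply: (eq_mult_bound (mult_boundM (h i) IH)) => g _.
by rewrite big_cons.
Qed.

(** Shifting all frequencies by [- h] multiplies the polynomial by a function of modulus 1, so its
    bound is unchanged. *)
Lemma mult_bound_translate E phi M h : mult_bound chi (translate E (- h)) phi M ->
  mult_bound chi E (fun g => phi (g - h)) M.
Proof.
move=> /mult_boundP hM; apply/mult_boundP => s c K us sE cK.
have inj : injective (fun g : Gamma => g - h) by exact: addIr.
have := hM [seq g - h | g <- s] (fun g => c (g + h)) K.
rewrite big_map; under eq_bigr do rewrite subrK; apply.
- by rewrite map_inj_uniq.
- by move=> g /mapP[k ks ->]; exists k => //; exact: sE.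
- move=> x; rewrite /trigpoly big_map.
  have -> : \sum_(g <- s) c (g - h + h) * chi x (g - h) =
            chi x (- h) * trigpoly chi s c x.
    by rewrite /trigpoly big_distrr /=; apply: eq_bigr => g _; rewrite subrK chiDr; ring.
  by rewrite cabsM cabs_chi mul1r.
Qed.

(** The character [g] alone is a test bounded by 1. *)
Lemma mult_bound_ge E phi M g : E g -> mult_bound chi E phi M -> cabs (phi g) <= M.
Proof.
move=> Eg /mult_boundP /(_ [:: g] (fun=> 1) 1); rewrite big_seq1 mul1r mulr1; apply => //.
  by move=> k; rewrite inE => /eqP ->.
by move=> x; rewrite /trigpoly big_seq1 mul1r cabs_chi.
Qed.

End dual_pairing.

(** * A cutoff on the circle *)


Section modulus_of_real_multiplier.
Variable R : realType.

(** Iteration for the smaller root [1 - sqrt (1 - y)] of [q = (y + q ^ 2) / 2]; each iterate is a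
    polynomial in [y] with nonnegative coefficients. *)
Fixpoint sqrt_iter (y : R) n : R :=
  if n is m.+1 then (y + sqrt_iter y m ^+ 2) / 2 else 0.

(** The error [e] passes to [e * (2 * (1 - a) - e) / 2], at most [e - e ^ 2 / 2]. This gives a decay
    like [2 / n] that is uniform in [a], including [a = 0], where convergence is not geometric. *)
Lemma sqrt_iter_error (a : R) n : 0 <= a <= 1 ->
  0 <= sqrt_iter (1 - a ^+ 2) n <= 1 - a /\
  n.+1%:R * (1 - a - sqrt_iter (1 - a ^+ 2) n) <= 2.
Proof.
move=> /andP[a0 a1]; elim: n => [|n [/andP[q0 qa] hn]].
  by rewrite /= lexx /= subr0; split; lra.
have m1 : 1 <= n.+1%:R :> R by rewrite ler1n.
rewrite /= [n.+2%:R]mulrS; move: q0 qa hn m1.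
set q := sqrt_iter _ n; move: (n.+1%:R : R) => m q0 qa hn m1.
have e1 : 1 - a - (1 - a ^+ 2 + q ^+ 2) / 2
          = (1 - a - q) * (1 - a + q) / 2 by field.
have qa2 : q ^+ 2 <= (1 - a) ^+ 2 by rewrite ler_pXn2r ?nnegrE //; lra.
split; first by apply/andP; split; nra.
rewrite e1.
set e := 1 - a - q; have e0 : 0 <= e by rewrite /e; lra.
have he : m * e <= 2 by [].
have -> : 1 - a + q = 2 * (1 - a) - e by rewrite /e; ring.
have step : e * (2 * (1 - a) - e) / 2 <= e - e ^+ 2 / 2 by nra.
apply: (@le_trans _ _ ((1 + m) * (e - e ^+ 2 / 2))).
  by rewrite ler_wpM2l //; lra.
have [h|h] := leP ((1 + m) * e) 2; first by nra.
have : e * 2 <= e * ((1 + m) * e) by rewrite ler_wpM2l // ltW.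
nra.
Qed.

Variables (G Gamma : topologicalZmodType) (chi : G -> Gamma -> R[i]).
Hypothesis dual : is_dual_pairing chi.

(* The iterates [Q' = (y + Q^2) / 2] keep norm at most 1 when [y = 1 - t^2] has,
   and increase to the fixed point [1 - |t|]. *)
Lemma mult_bound_norm E (t : Gamma -> R) : (forall g, `|t g| <= 1) ->
  mult_bound chi E (fun g => (1 - t g ^+ 2)%:C%C) 1 ->
  mult_bound chi E (fun g => `|t g|%:C%C) 2.
Proof.
move=> t1 hy.
have hq n : mult_bound chi E (fun g => (sqrt_iter (1 - t g ^+ 2) n)%:C%C) 1.
  elim: n => [|n IH] /=.
    by apply: le_mult_bound (mult_bound0 _ _) => //; exact: ler01.
  have := mult_boundZ (2^-1)%:C%C (mult_boundD hy (mult_boundM dual IH IH)).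
  rewrite cabs_real ger0_norm ?invr_ge0 // mulr1 (_ : 2^-1 * (1 + 1) = 1); last by field.
  move=> h; apply: (eq_mult_bound h) => g _.
  by rewrite -!rmorphM -rmorphD -rmorphM /=; congr (_ %:C)%C; field.
have h1 : mult_bound chi E (fun g => (1 - `|t g|)%:C%C) 1.
  apply: (mult_bound_lim hq) => g _ e e0.
  have [n hn] : exists n : nat, 2 / e < n%:R.
    by exists (Num.bound (2 / e)); apply: archi_boundP; rewrite divr_ge0 // ltW.
  exists n => m nm; rewrite -rmorphB cabs_real distrC.
  have t01 : 0 <= `|t g| <= 1 by rewrite normr_ge0 t1.
  have [/andP[q0 qa] hm] := sqrt_iter_error m t01.
  move: q0 qa hm; rewrite real_normK ?num_real // => q0 qa hm.
  rewrite ger0_norm ?subr_ge0 //.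
  have m2 : 2 / e < m.+1%:R.
    by apply: lt_le_trans hn _; rewrite ler_nat (leq_trans nm).
  rewrite -(@ltr_pM2l _ m.+1%:R) ?ltr0n //; apply: le_lt_trans hm _.
  by rewrite -ltr_pdivrMr.
have := mult_boundB (mult_bound1 dual E) h1.
rewrite (_ : 1 + 1 = 2) // => h; apply: (eq_mult_bound h) => g _.
by rewrite -(rmorph1 (real_complex R)) -rmorphB /=; congr (_ %:C)%C; ring.
Qed.

End modulus_of_real_multiplier.

Section circle_cutoff.
Variable R : realType.
Implicit Types (z w : R[i]).

Definition ramp w : R :=
  (1 + complex.Re w * `|complex.Re w| + complex.Im w * `|complex.Im w|) / 2.

(** Two points of the unit circle with product [i], taken from the triple 5, 12, 13 so that all
    coordinates are rational. After the two rotations the arcs where the ramps are 1 overlap in an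
    arc around 1, and the arcs of zeros unite to one around -1. *)
Definition rot1 : R[i] := Complex (5 / 13) (12 / 13).
Definition rot2 : R[i] := Complex (12 / 13) (5 / 13).

(* On the unit circle [ramp] is 1 on the first quadrant and 0 on the third one, so the
   rotated product is 1 near 1 and 0 on the arc [Re z <= - 5 / 13]. *)
Definition cutoff z : R := ramp (rot1 * z) * ramp (rot2 * z).

Lemma cabs_rot1 : cabs rot1 = 1.
Proof.
by rewrite /cabs /= (_ : _ + _ = 1) ?sqrtr1 //; field.
Qed.

Lemma cabs_rot2 : cabs rot2 = 1.
Proof.
by rewrite /cabs /= (_ : _ + _ = 1) ?sqrtr1 //; field.
Qed.

Lemma ramp_first_quadrant w :
  cabs w = 1 -> 0 <= complex.Re w -> 0 <= complex.Im w -> ramp w = 1.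
Proof.
move=> w1 a0 b0; have := sqr_cabs w; rewrite w1 expr1n /ramp !ger0_norm //.
by rewrite -!expr2 -addrA => <-; field.
Qed.

Lemma ramp_third_quadrant w :
  cabs w = 1 -> complex.Re w <= 0 -> complex.Im w <= 0 -> ramp w = 0.
Proof.
move=> w1 a0 b0; have := sqr_cabs w; rewrite w1 expr1n /ramp !ler0_norm //.
by rewrite !mulrN -!expr2 -addrA -opprD => <-; field.
Qed.

Lemma cutoff_eq1 z : cabs z = 1 -> 12 / 13 < complex.Re z -> cutoff z = 1.
Proof.
move=> z1; have := sqr_cabs z; rewrite z1 expr1n; case: z z1 => a b z1 /= ab a0.
have b1 : b < 5 / 13 by rewrite ltNge; apply/negP => h; nra.
have b2 : - (5 / 13) < b by rewrite ltNge; apply/negP => h; nra.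
by rewrite /cutoff !ramp_first_quadrant ?cabsM ?cabs_rot1 ?cabs_rot2 ?z1 ?mulr1 //=; lra.
Qed.

Lemma cutoff_eq0 z : cabs z = 1 -> complex.Re z <= - (5 / 13) -> cutoff z = 0.
Proof.
move=> z1; have := sqr_cabs z; rewrite z1 expr1n; case: z z1 => a b z1 /= ab a0.
have b1 : b <= 12 / 13 by rewrite leNgt; apply/negP => h; nra.
have b2 : - (12 / 13) <= b by rewrite leNgt; apply/negP => h; nra.
(* The upper half of the arc goes to the third quadrant under [rot1], the lower half under
   [rot2]. *)
rewrite /cutoff; have [b0|b0] := leP 0 b.
  by rewrite ramp_third_quadrant ?mul0r ?cabsM ?cabs_rot1 ?z1 ?mulr1 //=; lra.
rewrite [X in _ * X]ramp_third_quadrant ?mulr0 ?cabsM ?cabs_rot2 ?z1 ?mulr1 //=; lra.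
Qed.

(* Squaring [z] while [- 5 / 13 <= Re z] multiplies [1 - Re z] by at least [16 / 13]. *)
Lemma power_far_from_one z : cabs z = 1 -> z != 1 ->
  exists n, complex.Re (z ^+ (2 ^ n)) < - (5 / 13).
Proof.
move=> z1 zn1; apply: contrapT => /forallNP h.
have re1 n : cabs (z ^+ (2 ^ n)) = 1.
  elim: n => [|n IH]; first by rewrite expr1.
  by rewrite expnS mulnC exprM expr2 cabsM IH mulr1.
have step n : (16 / 13) * (1 - complex.Re (z ^+ (2 ^ n))) <=
    1 - complex.Re (z ^+ (2 ^ n.+1)).
  have := h n; have := re1 n; rewrite expnS mulnC exprM.
  set w := z ^+ _ => w1 /negP; rewrite -leNgt => wr.
  have := sqr_cabs w; rewrite w1 expr1n.
  have := normr_Re w; rewrite w1 ler_norml.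
  by rewrite expr2; case: w wr {w1} => a b /= ? /andP[? ?] ?; nra.
have d0 : 0 < 1 - complex.Re z.
  rewrite subr_gt0 lt_neqAle; apply/andP; split.
    apply/eqP => r1; move/eqP: zn1; apply.
    have := sqr_cabs z; rewrite z1 r1 expr1n; case: z r1 {z1 h re1 step} => a b /= ->.
    by move=> b2; rewrite (_ : b = 0) //; apply/eqP; rewrite -sqrf_eq0; apply/eqP; lra.
  by have := normr_Re z; rewrite z1; apply: le_trans; exact: ler_norm.
(* A Bernoulli bound in place of [(16 / 13) ^ n]; linear growth already contradicts the upper bound
   2 for [1 - Re]. *)
have lin n : (1 + n%:R * (3 / 13)) * (1 - complex.Re z) <= 1 - complex.Re (z ^+ (2 ^ n)).
  elim: n => [|n IH]; first by rewrite expn0 expr1 mul0r addr0 mul1r.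
  apply: le_trans (step n); rewrite mulrS.
  have n0 : 0 <= n%:R :> R by [].
  move: (n%:R : R) n0 IH => m m0; nra.
have := archi_boundP (divr_ge0 ler01 (ltW d0)) => /=.
set N := Num.bound _; rewrite ltr_pdivrMr // => hN.
(* Since [N * (1 - Re z) > 1], the factor 10 lifts the lower bound above [30 / 13 > 2]. *)
have := lin (10 * N)%N.
have := normr_Re (z ^+ (2 ^ (10 * N))); rewrite re1 ler_norml => /andP[+ _].
rewrite natrM; move: (N%:R : R) hN => m hN; nra.
Qed.

End circle_cutoff.

Section cutoff_multiplier.
Variables (R : realType) (G Gamma : topologicalZmodType) (chi : G -> Gamma -> R[i]).
Hypothesis dual : is_dual_pairing chi.
Variable E : set Gamma.

(** [Re] and [Im] have norm at most 1 as combinations of [w] and its conjugate. On the unit circle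
    [1 - Re ^ 2 = Im ^ 2], so [|Re|] has norm at most 2, and likewise [|Im|]. The total is
    [(1 + 2 + 2) / 2]. *)
Lemma mult_bound_ramp (w : Gamma -> R[i]) : (forall g, cabs (w g) = 1) ->
  mult_bound chi E w 1 -> mult_bound chi E (fun g => conjc (w g)) 1 ->
  mult_bound chi E (fun g => (ramp (w g))%:C%C) (5 / 2).
Proof.
move=> w1 hw hwc.
have hRe : mult_bound chi E (fun g => (complex.Re (w g))%:C%C) 1.
  have := mult_boundZ (2^-1)%:C%C (mult_boundD hw hwc).
  rewrite cabs_real ger0_norm ?invr_ge0 // (_ : 2^-1 * (1 + 1) = 1); last by field.
  move=> h; apply: (eq_mult_bound h) => g _.
  by case: (w g) => a b; apply/eqP; rewrite eq_complex /=; apply/andP; split; apply/eqP; field.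
have hIm : mult_bound chi E (fun g => (complex.Im (w g))%:C%C) 1.
  have := mult_boundZ (Complex 0 (2^-1)) (mult_boundB hwc hw).
  rewrite {1}/cabs /= expr0n add0r sqrtr_sqr ger0_norm ?invr_ge0 //.
  rewrite (_ : 2^-1 * (1 + 1) = 1); last by field.
  move=> h; apply: (eq_mult_bound h) => g _.
  by case: (w g) => a b; apply/eqP; rewrite eq_complex /=; apply/andP; split; apply/eqP; field.
have sq g : complex.Re (w g) ^+ 2 + complex.Im (w g) ^+ 2 = 1.
  by rewrite -sqr_cabs w1 expr1n.
have hnRe : mult_bound chi E (fun g => `|complex.Re (w g)|%:C%C) 2.
  apply: (mult_bound_norm dual) => [g|]; first by rewrite -(w1 g) normr_Re.
  have := mult_boundM dual hIm hIm; rewrite mulr1 => h.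
  apply: (eq_mult_bound h) => g _.
  by rewrite -rmorphM /= -(sq g); congr (_ %:C)%C; ring.
have hnIm : mult_bound chi E (fun g => `|complex.Im (w g)|%:C%C) 2.
  apply: (mult_bound_norm dual) => [g|]; first by rewrite -(w1 g) normr_Im.
  have := mult_boundM dual hRe hRe; rewrite mulr1 => h.
  apply: (eq_mult_bound h) => g _.
  by rewrite -rmorphM /= -(sq g); congr (_ %:C)%C; ring.
have := mult_boundZ (2^-1)%:C%C (mult_boundD (mult_boundD (mult_bound1 dual E)
  (mult_boundM dual hRe hnRe)) (mult_boundM dual hIm hnIm)).
rewrite cabs_real ger0_norm ?invr_ge0 // (_ : 2^-1 * _ = 5 / 2); last by field.
move=> h; apply: (eq_mult_bound h) => g _.
rewrite -!rmorphM -(rmorph1 (real_complex R)) -!rmorphD -rmorphM /=.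
by congr (_ %:C)%C; rewrite /ramp; field.
Qed.

(** The conjugate of a rotated character is a rotated character at [- x], so both have norm at most
    1. The bound depends neither on [x] nor on [E]. *)
Lemma mult_bound_cutoff x :
  mult_bound chi E (fun g => (cutoff (chi x g))%:C%C) (25 / 4).
Proof.
have h (r : R[i]) : cabs r = 1 ->
    mult_bound chi E (fun g => (ramp (r * chi x g))%:C%C) (5 / 2).
  move=> r1; apply: mult_bound_ramp => [g||].
  - by rewrite cabsM r1 (cabs_chi dual) mulr1.
  - by have := mult_boundZ r (mult_bound_chi chi E x); rewrite r1 mulr1.
  - have := mult_boundZ (conjc r) (mult_bound_chi chi E (- x)).
    rewrite cabs_conj r1 mulr1 => h; apply: (eq_mult_bound h) => g _.
    by rewrite (chiNl dual) -rmorphM.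
have := mult_boundM dual (h _ (@cabs_rot1 R)) (h _ (@cabs_rot2 R)).
rewrite (_ : 5 / 2 * (5 / 2) = 25 / 4); last by field.
by move=> h2; apply: (eq_mult_bound h2) => g _; rewrite -rmorphM.
Qed.

End cutoff_multiplier.

(** * Topological groups and continuity *)


(* [compact_cover] of the library asks for a pointed space. *)
Lemma compact_finite_cover (T : topologicalType) (K : set T) (U : T -> set T) :
  compact K -> (forall x, K x -> nbhs x (U x)) ->
  exists s : seq T, (forall x, x \in s -> K x) /\
    forall y, K y -> exists2 x, x \in s & U x y.
Proof.
move=> /compact_near_coveringP cK KU.
(* The filter of properties that hold for all lists containing some fixed list; what holds
   eventually along it holds for one finite subcover. *)
pose F : set_system (seq T) := [set P | exists s0 : seq T, forall s : seq T, {subset s0 <= s} -> P s].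
have FF : Filter F.
  split.
  - by exists [::].
  - move=> P Q [s hs] [t ht]; exists (s ++ t) => r sub; split.
      by apply: hs => x xs; apply: sub; rewrite mem_cat xs.
    by apply: ht => x xs; apply: sub; rewrite mem_cat xs orbT.
  - by move=> P Q PQ [s hs]; exists s => t /hs /PQ.
have [|s hs] := cK (seq T) F (fun s y => exists2 x, x \in s & K x /\ U x y) FF.
  move=> x Kx; exists (U x, [set s : seq T | x \in s]).
    split; first exact: KU.
    by exists [:: x] => s; apply; rewrite mem_head.
  by move=> [y s] /= [Uy xs]; exists x.
exists [seq x <- s | `[< K x >]]; split.
  by move=> x; rewrite mem_filter => /andP[/asboolP].
move=> y Ky; have [x xs [Kx Ux]] := hs s (fun _ h => h) y Ky.
by exists x => //; rewrite mem_filter xs andbT; apply/asboolP.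
Qed.

Section topological_group.
Variable T : topologicalZmodType.
Implicit Types (A B : set T) (g h : T).

Lemma compactB A B : compact A -> compact B ->
  compact [set x | exists2 a, A a & exists2 b, B b & x = a - b].
Proof.
move=> cA cB.
rewrite (_ : [set _ | _] = (fun x : T * T => x.1 - x.2) @` (A `*` B)).
  apply: continuous_compact; last exact: compact_setX.
  by apply: continuous_subspaceT; exact: sub_continuous.
apply/seteqP; split=> x; first by move=> [a Aa [b Bb ->]]; exists (a, b).
by move=> [[a b] [/= Aa Bb] <-]; exists a => //; exists b.
Qed.

Lemma compactD A B : compact A -> compact B ->
  compact [set x | exists2 a, A a & exists2 b, B b & x = a + b].
Proof.
move=> cA cB.
rewrite (_ : [set _ | _] = (fun x : T * T => x.1 + x.2) @` (A `*` B)).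
  apply: continuous_compact; last exact: compact_setX.
  by apply: continuous_subspaceT; exact: add_continuous.
apply/seteqP; split=> x; first by move=> [a Aa [b Bb ->]]; exists (a, b).
by move=> [[a b] [/= Aa Bb] <-]; exists a => //; exists b.
Qed.

Lemma translate_continuous h : continuous (fun g => g + h).
Proof.
move=> g; apply: (@continuous_comp _ _ _ (fun g => (g, h)) (fun x : T * T => x.1 + x.2)).
  by apply: cvg_pair; [exact: cvg_id|exact: cvg_cst].
exact: add_continuous.
Qed.

Lemma nbhs_translate g h A : nbhs (g + h) A -> nbhs g [set k | A (k + h)].
Proof. exact: translate_continuous. Qed.

Lemma nbhs_subr g A : nbhs 0 A -> nbhs g [set k | A (k - g)].
Proof. by move=> A0; apply: nbhs_translate; rewrite subrr. Qed.

Lemma nbhs0_sub A : nbhs 0 A -> exists2 W : set T, nbhs 0 W &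
  forall a b, W a -> W b -> A (a - b).
Proof.
move=> A0; have := @sub_continuous T (0, 0) A.
rewrite /= subr0 => /(_ A0) [[P Q] [/= P0 Q0] PQ].
exists (P `&` Q); first exact: filterI.
by move=> a b [Pa _] [_ Qb]; exact: (PQ (a, b)).
Qed.

(** An element is kept only when it is unrelated to all those kept so far. The relation expresses
    closeness and may fail to be transitive. *)
Lemma greedy_separated (R : T -> T -> Prop) (s : seq T) : (forall a, R a a) ->
  (forall a b, R a b -> R b a) ->
  exists t : seq T, [/\ uniq t, {in t &, forall a b, R a b -> a = b} &
    forall a, a \in s -> exists2 b, b \in t & R a b].
Proof.
move=> Rrefl Rsym; elim: s => [|x s [t [ut sep cov]]]; first by exists [::].
have [[b bt Rxb]|nR] := pselect (exists2 b, b \in t & R x b).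
  exists t; split => // a; rewrite inE => /orP[/eqP ->|/cov //].
  by exists b.
exists (x :: t); split.
- rewrite /= ut andbT; apply/negP => xt; apply: nR; exists x => //.
- move=> a b; rewrite !inE => /orP[/eqP ->|ta] /orP[/eqP ->|tb] // Rab.
  + by exfalso; apply: nR; exists b.
  + by exfalso; apply: nR; exists a => //; exact: Rsym.
  + exact: sep.
- move=> a; rewrite inE => /orP[/eqP ->|/cov [b bt Rab]].
    by exists x => //; rewrite mem_head.
  by exists b => //; rewrite inE bt orbT.
Qed.

End topological_group.

Section complex_continuity.
Variables (R : realType) (T : topologicalType).
Implicit Types (f h : T -> R[i]).

Lemma ccontinuousP f : ccontinuous f <->
  continuous (fun x => complex.Re (f x) : R) /\ continuous (fun x => complex.Im (f x) : R).
Proof.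
split=> [fc|[fr fi] x e e0].
  split=> x; apply/cvgrPdist_lt => e e0; have := fc x e e0;
    apply: filterS => y; apply: le_lt_trans; rewrite distrC.
    by have := normr_Re (f y - f x); case: (f y) => a b; case: (f x).
  by have := normr_Im (f y - f x); case: (f y) => a b; case: (f x).
have e2 : 0 < e / 2 by rewrite divr_gt0.
have /cvgrPdist_lt/(_ _ e2) hr := fr x; have /cvgrPdist_lt/(_ _ e2) hi := fi x.
apply: filterS2 hr hi => y hr hi; apply: le_lt_trans (cabs_le_ReIm _) _.
rewrite (splitr e); apply: ltrD.
  by rewrite distrC in hr; move: hr; case: (f y) => a b; case: (f x).
by rewrite distrC in hi; move: hi; case: (f y) => a b; case: (f x).
Qed.

Lemma ccontinuous_real (r : T -> R) : continuous r -> ccontinuous (fun x => (r x)%:C%C).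
Proof. by move=> rc; apply/ccontinuousP; split=> // x; exact: cvg_cst. Qed.

Lemma ccontinuousD f h : ccontinuous f -> ccontinuous h -> ccontinuous (fadd f h).
Proof.
move=> /ccontinuousP[fr fi] /ccontinuousP[hr hi]; apply/ccontinuousP; split=> x.
  rewrite (_ : (fun _ => _) = (fun x => complex.Re (f x) + complex.Re (h x))).
    by apply: cvgD; [exact: fr|exact: hr].
  by apply/funext => y; rewrite /fadd; case: (f y) => a b; case: (h y).
rewrite (_ : (fun _ => _) = (fun x => complex.Im (f x) + complex.Im (h x))).
  by apply: cvgD; [exact: fi|exact: hi].
by apply/funext => y; rewrite /fadd; case: (f y) => a b; case: (h y).
Qed.

Lemma ccontinuousM f h : ccontinuous f -> ccontinuous h -> ccontinuous (fmul f h).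
Proof.
move=> /ccontinuousP[fr fi] /ccontinuousP[hr hi]; apply/ccontinuousP; split=> x.
  rewrite (_ : (fun _ => _) = (fun x => complex.Re (f x) * complex.Re (h x)
                                 - complex.Im (f x) * complex.Im (h x))).
    by apply: cvgB; apply: cvgM; [exact: fr|exact: hr|exact: fi|exact: hi].
  by apply/funext => y; rewrite /fmul; case: (f y) => a b; case: (h y).
rewrite (_ : (fun _ => _) = (fun x => complex.Re (f x) * complex.Im (h x)
                                 + complex.Im (f x) * complex.Re (h x))).
  by apply: cvgD; apply: cvgM; [exact: fr|exact: hi|exact: fi|exact: hr].
by apply/funext => y; rewrite /fmul; case: (f y) => a b; case: (h y).
Qed.

Lemma ccontinuous_cst (a : R[i]) : ccontinuous (fun _ : T => a).
Proof. by move=> x e e0; apply: nearW => y; rewrite subrr cabs0. Qed.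

Lemma ccontinuous_cabs f : ccontinuous f -> continuous (fun x => cabs (f x) : R).
Proof.
move=> fc x; apply/cvgrPdist_lt => e e0; have := fc x e e0; apply: filterS => y.
by apply: le_lt_trans; rewrite distrC cabs_distD.
Qed.

Lemma continuous_ramp f : ccontinuous f -> continuous (fun x => ramp (f x)).
Proof.
move=> /ccontinuousP[fr fi] x; rewrite /ramp.
apply: cvgM; last exact: cvg_cst.
apply: cvgD; first apply: cvgD; first exact: cvg_cst.
  by apply: cvgM; [exact: fr|apply: cvg_norm; exact: fr].
by apply: cvgM; [exact: fi|apply: cvg_norm; exact: fi].
Qed.

Lemma continuous_cutoff f : ccontinuous f -> continuous (fun x => cutoff (f x)).
Proof.
move=> fc x; apply: cvgM.
  by apply: (@continuous_ramp (fmul (fun=> rot1 R) f)); apply: ccontinuousM => //;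
    exact: ccontinuous_cst.
by apply: (@continuous_ramp (fmul (fun=> rot2 R) f)); apply: ccontinuousM => //;
  exact: ccontinuous_cst.
Qed.

Lemma continuous_prod (I : eqType) (s : seq I) (F : I -> T -> R) :
  (forall i, continuous (F i)) -> continuous (fun x => \prod_(i <- s) F i x).
Proof.
move=> Fc; elim: s => [|i s IH] x.
  by under eq_fun do rewrite big_nil; exact: cvg_cst.
by under eq_fun do rewrite big_cons; apply: cvgM; [exact: Fc|exact: IH].
Qed.

End complex_continuity.

(** * Local units *)


Section local_units.
Variables (R : realType) (G Gamma : topologicalZmodType) (chi : G -> Gamma -> R[i]).
Hypothesis dual : is_dual_pairing chi.

Lemma ccontinuous_chi x : ccontinuous (chi x).
Proof.
move=> g e e0; case: dual => _ _ _ _ /(_ g [set h | cabs (chi x h - chi x g) < e]) [_]; apply.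
exists [set x], e; split => //; first exact: compact_set1.
by move=> h /= /(_ x); exact.
Qed.

(** Characters are continuous and separate points. *)
Lemma dual_hausdorff : hausdorff_space Gamma.
Proof.
move=> p q pq; apply: (chi_inj dual) => x; apply: contrapT => nxy.
have d0 : 0 < cabs (chi x p - chi x q).
  rewrite lt_neqAle cabs_ge0 andbT; apply/eqP => /esym/cabs_eq0/eqP.
  by rewrite subr_eq0 => /eqP.
have e0 : 0 < cabs (chi x p - chi x q) / 2 by rewrite divr_gt0.
have [y [/= yp yq]] := pq _ _ (ccontinuous_chi x p e0) (ccontinuous_chi x q e0).
have := cabsD (chi x p - chi x y) (chi x y - chi x q).
by rewrite subrKA leNgt [X in X + _]cabsB [ltRHS]splitr ltrD.
Qed.

Variable V : set Gamma.
Hypotheses (oV : open V) (V0 : V 0) (cV : compact (closure V)).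

Lemma closure_unit : closure V 0. Proof. exact: subset_closure. Qed.

Lemma exists_bump : exists2 r : Gamma -> R,
  [/\ continuous r, nbhs 0 [set g | r g = 1] & forall g, ~ closure V g -> r g = 0] &
  exists2 M, 0 <= M & forall h,
    mult_bound chi (translate (closure V) h) (fun g => (r g)%:C%C) M.
Proof.
(* The set [closure V + closure V - closure V] contains every translate of [closure V] that meets
   [V]. *)
pose U := [set x | exists2 a, (exists2 b, closure V b & exists2 c, closure V c & a = b + c)
  & exists2 b, closure V b & x = a - b].
have cU : compact U by apply: (compactB _ cV); exact: compactD.
have inU a b c : closure V a -> closure V b -> closure V c -> U (a + b - c).
  by move=> Va Vb Vc; exists (a + b); [exists a => //; exists b|exists c].
have cL : compact (U `&` ~` V).
  apply: (@subclosed_compact _ _ U) => //.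
  apply: closedI; first exact: compact_closed dual_hausdorff cU.
  exact: open_closedC.
have [y hy] : exists y : Gamma -> G, forall g, (U `&` ~` V) g ->
    complex.Re (chi (y g) g) < - (5 / 13).
  suff /choice [y hy] : forall g, exists y, (U `&` ~` V) g ->
    complex.Re (chi y g) < - (5 / 13) by exists y.
  move=> g; have [Lg|] := pselect ((U `&` ~` V) g); last by exists 0.
  (* A point outside [V] differs from 0, so some [chi x] is not 1 there. Repeated doubling of [x]
     squares the value until it enters the arc where [cutoff] is 0. *)
  have [x xg] : exists x, chi x g != 1.
    apply: contrapT => /forallNP h; case: Lg => _; apply.
    rewrite (_ : g = 0) //; apply: (chi_inj dual) => x.
    by rewrite (chi0 dual); have /negP := h x; rewrite negbK => /eqP.
  have [n hn] := power_far_from_one (cabs_chi dual x g) xg.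
  exists (x *+ (2 ^ n)) => _; rewrite (_ : chi _ g = chi x g ^+ (2 ^ n)) //.
  elim: (2 ^ n)%N => [|m IH]; first by rewrite mulr0n (chi0l dual).
  by rewrite mulrS (chiDl dual) IH exprS.
have [s [_ hs]] : exists s : seq Gamma, (forall g, g \in s -> (U `&` ~` V) g) /\
    forall h, (U `&` ~` V) h -> exists2 g, g \in s &
      complex.Re (chi (y g) h) < - (5 / 13).
  apply: (@compact_finite_cover _ _
    (fun g => [set h | complex.Re (chi (y g) h) < - (5 / 13)])) => // g Lg.
  have [Rc _] := (ccontinuousP (chi (y g))).1 (ccontinuous_chi (y g)).
  exact: (Rc g _ (lt_nbhsl (hy g Lg))).
pose F (g : Gamma) : R := \prod_(k <- s) cutoff (chi (y k) g).
have Fc : continuous F.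
  by apply: continuous_prod => k; apply: continuous_cutoff; exact: ccontinuous_chi.
have F0 g : (U `&` ~` V) g -> F g = 0.
  move=> /hs [k ks hk]; rewrite /F (big_rem k) //= cutoff_eq0 ?mul0r ?(cabs_chi dual) //.
  exact: ltW.
pose r g : R := if `[< V g >] then F g else 0.
have rV g : ~ V g -> r g = 0 by rewrite /r; case: asboolP.
have rU g : U g -> r g = F g.
  by move=> Ug; rewrite /r; case: asboolP => // nV; rewrite F0.
have subU g h v : closure V v -> closure V h -> g - h = v -> U g.
  move=> Vv Vh gh; rewrite -(subrK h g) gh -[_ + h]subr0.
  by apply: inU => //; exact: closure_unit.
exists r.
- split.
  (* Near a point of [closure V] all points lie in [U], where [r] is the continuous [F]; off
     [closure V], [r] is locally 0. *)
  + move=> g; have [Vg|nVg] := pselect (closure V g).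
      have gU : \forall h \near g, U h.
        have := nbhs_subr g (open_nbhs_nbhs (conj oV V0)).
        apply: filterS => h /= Vhg; apply: (@subU h g (h - g)) => //.
        exact: subset_closure.
      apply: (@cvg_trans _ (F h @[h --> g])).
        by apply: near_eq_cvg; apply: filterS gU => h /rU.
      by rewrite rU; [exact: Fc|exact: nbhs_singleton gU].
    have nV : \forall h \near g, ~ closure V h.
      by apply: open_nbhs_nbhs; split => //; apply: closed_openC; exact: closed_closure.
    apply: (@cvg_trans _ ((0 : R) @[h --> g])).
      by apply: near_eq_cvg; apply: filterS nV => h nVh; rewrite rV // => /subset_closure.
    by rewrite rV; [exact: cvg_cst|move=> /subset_closure].
  + have F1 : nbhs 0 [set g | F g = 1].
      rewrite /F; elim: {hs F Fc F0 r rV rU} s => [|k s IH].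
        by apply: filterS filterT => g _ /=; rewrite big_nil.
      have [Rc _] := (ccontinuousP (chi (y k))).1 (ccontinuous_chi (y k)).
      have k1 : nbhs 0 [set g | 12 / 13 < complex.Re (chi (y k) g)].
        have h0 : 12 / 13 < complex.Re (chi (y k) 0) by rewrite (chi0 dual) /=; lra.
        exact: (Rc 0 _ (lt_nbhsr h0)).
      apply: filterS2 IH k1 => g /= IH k1.
      by rewrite big_cons IH mulr1 cutoff_eq1 // (cabs_chi dual).
    apply: filterS2 F1 (open_nbhs_nbhs (conj oV V0)) => g /= F1 Vg.
    by rewrite /r; case: asboolP.
  + by move=> g nVg; apply: rV => /subset_closure.
- exists (\prod_(k <- s) (25 / 4)); first by apply: prodr_ge0 => k _; lra.
  move=> h; have [[k [Ek Vk]]|nE] := pselect (exists k, translate (closure V) h k /\ V k).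
    have hF : mult_bound chi (translate (closure V) h) (fun g => (F g)%:C%C)
        (\prod_(k <- s) (25 / 4)).
      have H := mult_bound_prod dual s
        (fun k => mult_bound_cutoff dual (translate (closure V) h) (y k)).
      by apply: (eq_mult_bound H) => g _; rewrite /F rmorph_prod.
    apply: (eq_mult_bound hF) => g [v Vv <-]; rewrite rU //.
    case: Ek => v' Vv' e; rewrite (_ : v + h = v + k - v'); last first.
      by rewrite -e addrCA [RHS]addrC addKr.
    by apply: inU => //; exact: subset_closure.
  apply: (@le_mult_bound _ _ _ _ _ _ 0); first by apply: prodr_ge0 => k _; lra.
  apply: (eq_mult_bound (mult_bound0 chi _)) => g Eg; rewrite rV // => Vg.
  by apply: nE; exists g.
Qed.

Lemma local_units : exists2 C : R, 0 <= C & forall K : set Gamma, compact K ->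
  exists2 u : Gamma -> R, continuous u /\ (forall g, K g -> u g = 1) &
    (exists2 D, compact D & forall g, ~ D g -> u g = 0) /\
    forall h, mult_bound chi (translate (closure V) h) (fun g => (u g)%:C%C) C.
Proof.
have [r [rc r1 r0] [M M0 hM]] := exists_bump.
have [W' W'0 hW'] := nbhs0_sub r1.
have [W W0 hW] := nbhs0_sub W'0.
(* [r] is 1 on [W + W - W]: a point of [K] is within [W] of some centre, and that centre differs
   from a kept one by an element of [W - W]. *)
have WWW a b c : W a -> W b -> W c -> r (a + (b - c)) = 1.
  move=> Wa Wb Wc; rewrite addrC -[a]opprK; apply: hW'; first exact: hW.
  by rewrite -sub0r; apply: hW => //; exact: nbhs_singleton.
(* The number of translates of [W] covering [closure V - closure V] fixes the constant before [K] is
   given. *)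
have [sQ [_ hQ]] := compact_finite_cover (compactB cV cV)
  (fun q _ => nbhs_subr q W0).
exists (1 + (1 + M) ^+ size sQ); first by rewrite addr_ge0 // exprn_ge0 // addr_ge0.
move=> K cK; have [sK [_ hK]] := compact_finite_cover cK (fun k _ => nbhs_subr k W0).
(* Two points of one translate of [W] are close, so such a translate contains at most one point of
   the separated list [t]. *)
pose close (a b : Gamma) := exists2 w1, W w1 & exists2 w2, W w2 & a - b = w1 - w2.
have [||t [ut sep cov]] := @greedy_separated _ close sK.
- by move=> a; exists 0; [exact: nbhs_singleton|exists 0; [exact: nbhs_singleton|rewrite !subrr]].
- by move=> a b [w1 W1 [w2 W2 e]]; exists w2 => //; exists w1 => //; rewrite -opprB e opprB.
pose u g : R := 1 - \prod_(a <- t) (1 - r (g - a)).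
exists u.
  split.
    move=> g; apply: cvgB; first exact: cvg_cst.
    apply: (@continuous_prod _ _ _ t (fun a g => 1 - r (g - a))) => a {}g.
    apply: cvgB; first exact: cvg_cst.
    by apply: continuous_comp; [exact: translate_continuous|exact: rc].
  move=> g /hK [k ks /= Wk]; have [a ta [w1 W1 [w2 W2 e]]] := cov k ks.
  rewrite /u (big_rem a) //= (_ : g - a = (g - k) + (w1 - w2)).
    by rewrite WWW // subrr mul0r subr0.
  by rewrite -e addrA subrK.
split.
  exists [set g | exists2 a, [set` t] a & exists2 c, closure V c & g = a + c].
    by apply: compactD => //; apply: finite_compact; exact: finite_seq.
  move=> g nD; rewrite /u big_seq big1 ?subrr // => a ta.
  rewrite r0 ?subr0 // => Va; apply: nD; exists a => //; exists (g - a) => //.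
  by rewrite addrC subrK.
move=> h; pose E := translate (closure V) h.
(* When [P a] fails, [r (g - a)] is 0 for all [g] in [E], and the factor of [a] is 1 there. *)
pose P a := `[< exists2 v, closure V v & closure V (v + h - a) >].
pose B a := if P a then 1 + M else 1.
have hB a : mult_bound chi E (fun g => (1 - r (g - a))%:C%C) (B a).
  rewrite /B /P; case: asboolP => [_|nP].
    have h1 : mult_bound chi (translate E (- a)) (fun g => (r g)%:C%C) M.
      have sE : translate E (- a) `<=` translate (closure V) (h - a).
        by move=> _ [_ [v Vv <-] <-]; exists v => //; rewrite addrA.
      exact: sub_mult_bound sE (hM (h - a)).
    have H := mult_boundB (mult_bound1 dual E) (mult_bound_translate dual h1).
    by apply: (eq_mult_bound H) => g _; rewrite rmorphB.
  apply: (eq_mult_bound (mult_bound1 dual E)) => _ [v Vv <-].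
  by rewrite r0 ?subr0 // => Vd; apply: nP; exists v.
have hP := mult_boundB (mult_bound1 dual E) (mult_bound_prod dual t hB).
have H : mult_bound chi E (fun g => (u g)%:C%C) (1 + \prod_(a <- t) B a).
  by apply: (eq_mult_bound hP) => g _; rewrite /u rmorphB rmorph_prod.
apply: (le_mult_bound _ H); rewrite lerD2l.
have -> : \prod_(a <- t) B a = (1 + M) ^+ count P t.
  elim: (t) => [|a t' IH]; first by rewrite big_nil.
  by rewrite big_cons IH /B /=; case: (P a) => /=; rewrite ?exprS ?mul1r.
apply: ler_weXn2l; first by rewrite lerDl.
(* If [P a] holds, [a - h] is in [closure V - closure V], hence in the translate of [W] labelled by
   [q a]. Separation makes [q] injective on these points, so there are at most [size sQ] of them. *)
have /choice [q hq] : forall a, exists q, P a -> q \in sQ /\ W (a - h - q).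
  move=> a; have [|nP] := boolP (P a); last by exists 0.
  move=> /asboolP [v Vv Vd].
  have [|q qs Wq] := hQ (a - h); last by exists q.
  by exists v => //; exists (v + h - a) => //; rewrite opprB opprD addrCA addNKr.
rewrite -size_filter -(size_map q); apply: uniq_leq_size.
  rewrite map_inj_in_uniq ?filter_uniq // => a b.
  rewrite !mem_filter => /andP[Pa ta] /andP[Pb tb] e; apply: sep => //.
  have [_ Wa] := hq a Pa; have [_ Wb] := hq b Pb.
  exists (a - h - q a) => //; exists (b - h - q b) => //.
  by rewrite e opprB addrA subrK opprB addrA subrK.
by move=> _ /mapP[a + ->]; rewrite mem_filter => /andP[Pa _]; have [] := hq a Pa.
Qed.

End local_units.

(** * The algebra A(Gamma) *)


Lemma compact_setU (T : topologicalType) (A B : set T) :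
  compact A -> compact B -> compact (A `|` B).
Proof.
move=> cA cB; have := @bigsetU_compact T bool (fun b => if b then A else B) [:: true; false] xpredT.
by rewrite !big_cons big_nil setU0; apply; case.
Qed.

Lemma KdirU (T : topologicalType) (A B : set T) : Kdir A -> Kdir B -> Kdir (A `|` B).
Proof.
move=> [cA [x Ax] sA] [cB _ sB].
have iA : A° `<=` (A `|` B)° by apply: interiorS; exact: subsetUl.
have iB : B° `<=` (A `|` B)° by apply: interiorS; exact: subsetUr.
split; first exact: compact_setU.
  by exists x; exact: iA.
by move=> y [/sA|/sB]; exact: closureS.
Qed.

Lemma cauchy_complex (R : realType) (z : nat -> R[i]) :
  (forall e, 0 < e -> exists n0, forall m n, (n0 <= m)%N -> (n0 <= n)%N ->
    cabs (z m - z n) < e) ->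
  exists l, forall e, 0 < e -> exists n0, forall n, (n0 <= n)%N -> cabs (z n - l) < e.
Proof.
move=> hz.
have h (P : R[i] -> R) : (forall x y, `|P x - P y| <= cabs (x - y)) ->
    cvgn (fun n => P (z n)).
  move=> hP; apply/cauchy_cvgP; apply: cauchy_exP => e e0.
  have [n0 hn0] := hz e e0; exists (P (z n0)); exists n0 => // n /= n0n.
  by rewrite /ball /= (le_lt_trans (hP _ _)) // hn0.
have hr : cvgn (fun n => complex.Re (z n) : R).
  by apply: h => x y; have := normr_Re (x - y); case: x => a b; case: y.
have hi : cvgn (fun n => complex.Im (z n) : R).
  by apply: h => x y; have := normr_Im (x - y); case: x => a b; case: y.
exists (Complex (lim ((fun n => complex.Re (z n) : R) @ \oo))
                (lim ((fun n => complex.Im (z n) : R) @ \oo))) => e e0.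
have e2 : 0 < e / 2 by rewrite divr_gt0.
move/cvgrPdist_lt: hr => /(_ _ e2) hr; move/cvgrPdist_lt: hi => /(_ _ e2) hi.
have [n0 _ hn0] := filterI hr hi; exists n0 => n /hn0 [].
rewrite distrC => nr; rewrite distrC => ni.
apply: le_lt_trans (cabs_le_ReIm _) _; rewrite (splitr e).
by apply: ltrD; [move: nr|move: ni]; case: (z n).
Qed.

Section bse_algebra.
Variables (R : realType) (G Gamma : topologicalZmodType) (chi : G -> Gamma -> R[i]).
Hypothesis dual : is_dual_pairing chi.
Variable V : set Gamma.
Hypotheses (oV : open V) (V0 : V 0) (cV : compact (closure V)).
Implicit Types (f w phi : Gamma -> R[i]) (M C : R).

Definition unif_bound f M := forall h, mult_bound chi (translate (closure V) h) f M.

Lemma bse_norm_leP phi M : (bse_norm chi V phi <= M%:E)%E <-> unif_bound phi M.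
Proof.
split=> [h g|h]; last by apply: ge_ereal_sup => _ [g _ <-]; exact: h.
by apply: le_trans h; apply: ereal_sup_ubound; exists g.
Qed.

Lemma bse_norm_ge0 phi : (0 <= bse_norm chi V phi)%E.
Proof.
apply: (@le_trans _ _ (bse_norm_at chi V 0 phi)); last first.
  by apply: ereal_sup_ubound; exists 0.
apply: ereal_sup_ubound; exists [::], (fun=> 0); split => //.
  by move=> x; rewrite /trigpoly big_nil cabs0 ler01.
by rewrite big_nil cabs0.
Qed.

Lemma bse_norm_fin phi : (bse_norm chi V phi < +oo)%E -> bse_norm chi V phi \is a fin_num.
Proof. by move=> h; rewrite ge0_fin_numE // bse_norm_ge0. Qed.

Lemma unif_bound_fine phi : (bse_norm chi V phi < +oo)%E ->
  unif_bound phi (fine (bse_norm chi V phi)).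
Proof. by move=> h; apply/bse_norm_leP; rewrite fineK // bse_norm_fin. Qed.

Lemma unif_bound_ltey phi M : unif_bound phi M -> (bse_norm chi V phi < +oo)%E.
Proof. by move=> /bse_norm_leP h; apply: le_lt_trans h _; exact: ltry. Qed.

Lemma unif_bound_ge phi M g : unif_bound phi M -> cabs (phi g) <= M.
Proof.
move=> /(_ g); apply: mult_bound_ge => //.
by exists 0; [exact: closure_unit|rewrite add0r].
Qed.

Lemma unif_bound_ge0 phi M : unif_bound phi M -> 0 <= M.
Proof. by move=> /(unif_bound_ge 0); exact: le_trans (cabs_ge0 _). Qed.

Lemma unif_boundD f w M C : unif_bound f M -> unif_bound w C ->
  unif_bound (fadd f w) (M + C).
Proof. by move=> hf hw h; exact: mult_boundD. Qed.

Lemma unif_boundM f w M C : unif_bound f M -> unif_bound w C ->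
  unif_bound (fmul f w) (M * C).
Proof. by move=> hf hw h; exact: mult_boundM. Qed.

Lemma unif_boundZ f M (a : R[i]) : unif_bound f M -> unif_bound (fscale a f) (cabs a * M).
Proof. by move=> hf h; exact: mult_boundZ. Qed.

Lemma unif_bound_lim (phi : nat -> Gamma -> R[i]) f M n0 :
  (forall n, (n0 <= n)%N -> unif_bound (phi n) M) ->
  (forall g e, 0 < e -> exists N, forall n, (N <= n)%N -> cabs (phi n g - f g) < e) ->
  unif_bound f M.
Proof.
move=> hb lim_phi h; apply: (@mult_bound_lim _ _ _ _ _ (fun n => phi (n0 + n)%N)).
  by move=> n; apply: hb; exact: leq_addr.
move=> g _ e /(lim_phi g) [N hN]; exists N => n Nn.
by apply: hN; exact: leq_trans (leq_addl _ _).
Qed.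

(** The supremum over the complement of [O] decreases as [O] grows, so the limit along the directed
    family reduces to one set [B] for each [e]. Boundedness of [f] follows from the norm bound. *)
Lemma A_algP f : A_alg chi V f <-> [/\ ccontinuous f, exists M, unif_bound f M &
  forall e, 0 < e -> exists2 B, Kdir B &
    forall h, ~ B h -> mult_bound chi (translate (closure V) h) f e].
Proof.
split=> [[[[fc _] fV] fd]|[fc [M fM] fd]].
  split => //; first by exists (fine (bse_norm chi V f)); exact: unif_bound_fine.
  move=> e /fd [B KB hB]; exists B => // h nBh.
  apply: le_trans _ (hB B KB (@subset_refl _ B)).
  by apply: ereal_sup_ubound; exists h.
split.
  split; last exact: unif_bound_ltey fM.
  by split => //; exists M => g; exact: unif_bound_ge.
move=> e /fd [B KB hB]; exists B => // B' KB' BB'.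
by apply: ge_ereal_sup => _ [h nBh <-]; apply: hB => /BB'.
Qed.

Lemma A_algD f w : A_alg chi V f -> A_alg chi V w -> A_alg chi V (fadd f w).
Proof.
move=> /A_algP[fc [M fM] fd] /A_algP[wc [C wC] wd]; apply/A_algP; split.
- exact: ccontinuousD.
- by exists (M + C); exact: unif_boundD.
- move=> e e0; have e2 : 0 < e / 2 by rewrite divr_gt0.
  have [B1 K1 h1] := fd _ e2; have [B2 K2 h2] := wd _ e2.
  exists (B1 `|` B2); first exact: KdirU.
  move=> h /not_orP [n1 n2]; rewrite (splitr e).
  by apply: mult_boundD; [exact: h1|exact: h2].
Qed.

(** Local norms multiply, so the decay of [f] passes to its product with any bounded multiplier;
    this also covers scalars. *)
Lemma A_algM f w M : A_alg chi V f -> ccontinuous w -> unif_bound w M ->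
  A_alg chi V (fmul f w).
Proof.
move=> /A_algP[fc [C fC] fd] wc wM; apply/A_algP; split.
- exact: ccontinuousM.
- by exists (C * M); exact: unif_boundM.
- move=> e e0; have M1 : 0 < M + 1 by rewrite ltr_wpDl // (unif_bound_ge0 wM).
  have [B KB hB] := fd _ (divr_gt0 e0 M1); exists B => // h /hB hf.
  apply: (le_mult_bound _ (mult_boundM dual hf (wM h))).
  rewrite mulrAC ler_pdivrMr // ler_wpM2l ?ltW //.
  by rewrite ltrDl.
Qed.

Lemma A_algZ (a : R[i]) f : A_alg chi V f -> A_alg chi V (fscale a f).
Proof.
move=> fA; rewrite (_ : fscale a f = fmul f (fun=> a)).
  by apply: (A_algM fA (ccontinuous_cst a)) => h; exact: mult_bound_cst.
by apply/funext => g; rewrite /fscale /fmul mulrC.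
Qed.

Lemma A_algB f w : A_alg chi V f -> A_alg chi V w -> A_alg chi V (fsub f w).
Proof.
move=> fA /(A_algZ (-1)) wA; have := A_algD fA wA.
by congr (A_alg _ _ _); apply/funext => g; rewrite /fadd /fscale mulN1r.
Qed.

(** The norm dominates every value, so the sequence converges uniformly, and norm bounds pass to
    pointwise limits. Continuity, finiteness of the norm and decay are then inherited from one
    sufficiently close [u n0]. *)
Lemma A_alg_complete (u : nat -> Gamma -> R[i]) : (forall n, A_alg chi V (u n)) ->
  (forall e, 0 < e -> exists n0, forall m n, (n0 <= m)%N -> (n0 <= n)%N ->
    unif_bound (fsub (u m) (u n)) e) ->
  exists f, [/\ A_alg chi V f,
    forall g e, 0 < e -> exists n0, forall n, (n0 <= n)%N -> cabs (u n g - f g) < e &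
    forall e, 0 < e -> exists n0, forall n, (n0 <= n)%N -> unif_bound (fsub (u n) f) e].
Proof.
move=> uA hu.
have /choice [f hf] : forall g, exists l, forall e, 0 < e ->
    exists n0, forall n, (n0 <= n)%N -> cabs (u n g - l) < e.
  move=> g; apply: cauchy_complex => e e0.
  have e2 : 0 < e / 2 by rewrite divr_gt0.
  have [n0 hn0] := hu _ e2; exists n0 => m n nm nn.
  apply: le_lt_trans (unif_bound_ge g (hn0 m n nm nn)) _.
  by rewrite ltr_pdivrMr // ltr_pMr // ltr1n.
have hn e : 0 < e -> exists n0, forall n, (n0 <= n)%N -> unif_bound (fsub (u n) f) e.
  (* With [n] fixed, [m] tends to infinity in the Cauchy estimate. *)
  move=> /hu [n0 hn0]; exists n0 => n nn.
  apply: (@unif_bound_lim (fun m => fsub (u n) (u m)) _ _ n0).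
    by move=> m nm; exact: hn0.
  move=> g e' e'0; have [N hN] := hf g e' e'0; exists N => m Nm.
  rewrite /fsub (_ : _ - _ - _ = - (u m g - f g)) ?cabsN; first exact: hN.
  by ring.
exists f; split => //; apply/A_algP; split.
- move=> x e e0; have e3 : 0 < e / 3 by rewrite divr_gt0.
  have [n0 /(_ n0 (leqnn _)) hb] := hn _ e3.
  have /A_algP[uc _ _] := uA n0.
  apply: filterS (uc x _ e3) => y hy.
  rewrite (_ : f y - f x = fsub (u n0) f x - fsub (u n0) f y + (u n0 y - u n0 x)); last first.
    by rewrite /fsub; ring.
  rewrite (_ : e = e / 3 + e / 3 + e / 3); last by field.
  apply: le_lt_trans (cabsD _ _) _; apply: ler_ltD => //.
  apply: le_trans (cabsD _ _) _; rewrite cabsN.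
  by apply: lerD; exact: unif_bound_ge hb.
- have [n0 /(_ n0 (leqnn _)) hb] := hn 1 ltr01.
  have /A_algP[_ [M uM] _] := uA n0.
  exists (M + 1) => h; apply: (eq_mult_bound (mult_boundB (uM h) (hb h))) => g _.
  by rewrite /fsub opprB addrC subrK.
- move=> e e0; have e2 : 0 < e / 2 by rewrite divr_gt0.
  have [n0 /(_ n0 (leqnn _)) hb] := hn _ e2.
  have /A_algP[_ _ ud] := uA n0; have [B KB hB] := ud _ e2; exists B => // h nBh.
  rewrite (splitr e); apply: (eq_mult_bound (mult_boundB (hB h nBh) (hb h))) => g _.
  by rewrite /fsub opprB addrC subrK.
Qed.

(** An open set lies in the interior of its closure, so the closure of [K + V], compact as a closed
    part of [K + closure V], has dense interior. The point 0 is first added to [K] so that the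
    interior is nonempty even for empty [K]. *)
Lemma Kdir_superset (K : set Gamma) : compact K -> exists2 B, Kdir B & K `<=` B.
Proof.
move=> cK; pose K' := [set 0] `|` K.
pose U := [set x | exists2 k, K' k & V (x - k)].
have cK' : compact K' by apply: compact_setU => //; exact: compact_set1.
have oU : open U.
  rewrite openE => x [k Kk Vk].
  have : nbhs x [set y | V (y - k)].
    by apply: (@nbhs_translate _ x (- k)); exact: (open_nbhs_nbhs (conj oV Vk)).
  by apply: filterS => y Vy; exists k.
have sU : U `<=` (closure U)° by rewrite -open_subsetE //; exact: subset_closure.
exists (closure U).
- split.
  + have cKV := compactD cK' cV.
    apply: (subclosed_compact _ cKV); first exact: closed_closure.
    have := compact_closed (dual_hausdorff dual) cKV; rewrite closure_id => ->.
    apply: closureS => x [k Kk Vk]; exists k => //; exists (x - k); first exact: subset_closure.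
    by rewrite addrC subrK.
  + by exists 0; apply: sU; exists 0; [left|rewrite subr0].
  + exact: closureS.
- by move=> k Kk; apply: subset_closure; exists k; [right|rewrite subrr].
Qed.

Lemma A_alg_local_units : exists2 C, 0 <= C & forall K : set Gamma, compact K ->
  exists u, [/\ A_alg chi V u, unif_bound u C, forall g, K g -> u g = 1 &
    exists2 D, compact D & forall g, ~ D g -> u g = 0].
Proof.
have [C C0 hC] := local_units dual oV V0 cV; exists C => // K /hC [r [rc r1] [[D cD rD] hr]].
have rcc := ccontinuous_real rc.
exists (fun g => (r g)%:C%C); split => //; last first.
- by exists D => // g /rD ->.
- by move=> g /r1 ->.
apply/A_algP; split => //; first by exists C.
(* The translate of [closure V] by [h] meets [D] only if [h] lies in [D - closure V]. *)
move=> e e0; have [B KB sB] := Kdir_superset (compactB cD cV).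
exists B => // h nBh; apply: (@le_mult_bound _ _ _ _ _ _ 0); first exact: ltW.
apply: (eq_mult_bound (mult_bound0 chi _)) => _ [v Vv <-].
rewrite rD // => Dv; apply: nBh; apply: sB; exists (v + h) => //; exists v => //.
by rewrite addrC addrA addNr add0r.
Qed.

(** Off some compact [B] the local norm of [f] is at most [e / (1 + C)]; let [u] be 1 on
    [B + closure V]. Then [f - u f] is 0 on translates by points of [B], and on the others the
    factor [1 - u] of norm at most [1 + C] gives [e]. *)
Lemma A_alg_approximate_units : exists2 C, 0 <= C & forall f, A_alg chi V f ->
  forall e, 0 < e -> exists u, [/\ A_alg chi V u, unif_bound u C,
    exists2 D, compact D & forall g, ~ D g -> u g = 0 &
    unif_bound (fsub f (fmul u f)) e].
Proof.
have [C C0 hC] := A_alg_local_units; exists C => // f /A_algP[fc _ fd] e e0.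
have C1 : 0 < 1 + C by rewrite ltr_pwDl.
have [B [cB _ _] hB] := fd _ (divr_gt0 e0 C1).
have [u [uA uC u1 uD]] := hC _ (compactD cB cV).
exists u; split => // h; have [Bh|nBh] := pselect (B h).
  apply: (@le_mult_bound _ _ _ _ _ _ 0); first exact: ltW.
  apply: (eq_mult_bound (mult_bound0 chi _)) => _ [v Vv <-].
  rewrite /fsub /fmul u1 ?mul1r ?subrr //.
  by exists h => //; exists v => //; rewrite addrC.
have := mult_boundM dual (mult_boundB (mult_bound1 dual _) (uC h)) (hB h nBh).
rewrite mulrC divfK ?gt_eqF // => H; apply: (eq_mult_bound H) => g _.
by rewrite /fsub /fmul mulrBl mul1r.
Qed.

End bse_algebra.

(** * Norms of nonnegative functions in L^p *)


Lemma cvg_powR (R : realType) (p : R) (a : nat -> R) (l : R) : 1 <= p ->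
  (forall n, 0 <= a n) -> a @ \oo --> l -> (fun n => a n `^ p) @ \oo --> l `^ p.
Proof.
move=> p1 a0 al.
have p0 : 0 < p by exact: lt_le_trans p1.
have l0 : 0 <= l.
  by rewrite -(cvg_lim (@Rhausdorff R) al); apply: limr_ge; [exact: cvgP al|exact: nearW].
move: l0; rewrite le_eqVlt => /predU1P[l0|l0].
  (* The formula through [ln] breaks down at 0; there [a n ^ p <= a n] as soon as [a n <= 1]. *)
  move: al; rewrite -l0 powR0 ?gt_eqF // => al.
  apply: (@squeeze_cvgr _ _ _ _ (fun=> 0) a) => //; last exact: cvg_cst.
  have /cvgrPdist_lt/(_ 1 ltr01) := al; apply: filterS => n.
  rewrite sub0r normrN ger0_norm // => a1; rewrite powR_ge0 /=.
  have := a0 n; rewrite le_eqVlt => /predU1P[<-|an]; first by rewrite powR0 ?gt_eqF.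
  by apply: ge1r_powR => //; rewrite an ltW.
have h : {for l, continuous (fun x : R => expR (p * ln x))}.
  apply: continuous_comp; last exact: continuous_expR.
  by apply: cvgM; [exact: cvg_cst|exact: continuous_ln].
have := cvg_comp _ _ al h; rewrite {2}/powR gt_eqF //; apply: cvg_trans.
apply: near_eq_cvg; near=> n.
rewrite /powR gt_eqF //; near: n.
exact: (al _ (lt_nbhsr l0)).
Unshelve. all: by end_near. Qed.

Section nonnegative_Lnorm.
Context d (T : measurableType d) (R : realType) (mu : {measure set T -> \bar R}).
Variable p : R.
Hypothesis p1 : 1 <= p.
Implicit Types (a b : T -> R).

Let p0 : 0 < p. Proof. exact: lt_le_trans p1. Qed.

Lemma Lnorm_nneg_pow a : (forall x, 0 <= a x) ->
  (Lnorm mu p%:E (fun x => (a x)%:E) `^ p = \int[mu]_x ((a x `^ p)%:E))%E.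
Proof.
move=> a0; rewrite poweR_Lnorm ?gt_eqF //; apply: eq_integral => x _.
by rewrite /= ger0_norm // poweR_EFin.
Qed.

Lemma ler_poweR_nneg (x y : \bar R) : (0 <= x)%E -> (0 <= y)%E ->
  (x `^ p <= y `^ p)%E -> (x <= y)%E.
Proof.
move=> x0 y0 h.
have := @gt0_ler_poweR R p^-1 _ (x `^ p)%E (y `^ p)%E.
rewrite -!poweRrM mulfV ?gt_eqF // !poweRe1 //; apply => //.
- by rewrite invr_ge0 ltW.
- by rewrite in_itv /= poweR_ge0 leey.
- by rewrite in_itv /= poweR_ge0 leey.
Qed.

Lemma Lnorm_leP a e : (forall x, 0 <= a x) -> 0 <= e ->
  (Lnorm mu p%:E (fun x => (a x)%:E) <= e%:E)%E <->
  (\int[mu]_x ((a x `^ p)%:E) <= (e `^ p)%:E)%E.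
Proof.
move=> a0 e0; rewrite -Lnorm_nneg_pow // -poweR_EFin; split => h.
  apply: gt0_ler_poweR => //; rewrite ?in_itv /= ?Lnorm_ge0 ?leey ?lee_fin ?e0 //.
  exact: ltW.
by apply: ler_poweR_nneg => //; rewrite ?Lnorm_ge0 ?lee_fin.
Qed.

Lemma measurable_powRE a : measurable_fun setT a ->
  measurable_fun setT (fun x => (a x `^ p)%:E).
Proof.
move=> ma; apply/measurable_EFinP.
exact: (measurableT_comp (measurable_powR p) ma).
Qed.

Lemma le_Lnorm a b : measurable_fun setT a -> measurable_fun setT b ->
  (forall x, 0 <= a x <= b x) ->
  (Lnorm mu p%:E (fun x => (a x)%:E) <= Lnorm mu p%:E (fun x => (b x)%:E))%E.
Proof.
move=> ma mb ab.
have a0 x : 0 <= a x by have /andP[] := ab x.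
have b0 x : 0 <= b x by have /andP[h1 h2] := ab x; exact: le_trans h2.
apply: ler_poweR_nneg; rewrite ?Lnorm_ge0 // !Lnorm_nneg_pow //.
apply: ge0_le_integral => //.
- by move=> x _; rewrite lee_fin powR_ge0.
- exact: measurable_powRE.
- exact: measurable_powRE.
- move=> x _; rewrite lee_fin; have /andP[_ h] := ab x.
  by apply: ge0_ler_powR; rewrite ?nnegrE // ltW.
Qed.

Lemma LnormZ_nneg a (c : R) : measurable_fun setT a -> (forall x, 0 <= a x) -> 0 <= c ->
  Lnorm mu p%:E (fun x => (c * a x)%:E) = (c%:E * Lnorm mu p%:E (fun x => (a x)%:E))%E.
Proof.
move=> ma a0 c0.
have h : (Lnorm mu p%:E (fun x => (c * a x)%:E) `^ p
          = (c%:E * Lnorm mu p%:E (fun x => (a x)%:E)) `^ p)%E.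
  rewrite poweRM ?lee_fin ?Lnorm_ge0 // !Lnorm_nneg_pow // => [|x]; last exact: mulr_ge0.
  rewrite poweR_EFin -ge0_integralZl //.
  - by apply: eq_integral => x _; rewrite powRM // EFinM.
  - exact: measurable_powRE.
  - by move=> x _; rewrite lee_fin powR_ge0.
  - by rewrite lee_fin powR_ge0.
have N0 : (0 <= c%:E * Lnorm mu p%:E (fun x => (a x)%:E))%E.
  by rewrite mule_ge0 ?lee_fin ?Lnorm_ge0.
by apply/eqP; rewrite eq_le; apply/andP; split; apply: ler_poweR_nneg;
  rewrite ?Lnorm_ge0 // h.
Qed.

Lemma Lnorm_bounded_lty a (c : R) (K : set T) : measurable_fun setT a -> measurable K ->
  (mu K < +oo)%E -> (forall x, 0 <= a x <= c) -> (forall x, ~ K x -> a x = 0) ->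
  (Lnorm mu p%:E (fun x => (a x)%:E) < +oo)%E.
Proof.
move=> ma mK Koo ac aK.
have a0 x : 0 <= a x by have /andP[] := ac x.
suff : (Lnorm mu p%:E (fun x => (a x)%:E) `^ p < +oo)%E by apply: lty_poweRy; rewrite gt_eqF.
rewrite Lnorm_nneg_pow //.
apply: (@le_lt_trans _ _ (\int[mu]_x ((c `^ p)%:E * (\1_K x)%:E))%E).
  apply: ge0_le_integral => //.
  - by move=> x _; rewrite lee_fin powR_ge0.
  - exact: measurable_powRE.
  - by apply: measurable_funeM; apply/measurable_EFinP; exact: measurable_indic.
  - move=> x _; rewrite -EFinM lee_fin; have [Kx|nKx] := pselect (K x).
      rewrite indicE mem_set // mulr1; have /andP[? h] := ac x.
      have c0 : 0 <= c by exact: le_trans h.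
      by apply: ge0_ler_powR; rewrite ?nnegrE //; exact: ltW.
    by rewrite aK // powR0 ?gt_eqF // mulr_ge0 ?powR_ge0.
rewrite ge0_integralZl // ?lee_fin ?powR_ge0 //; last first.
  by apply/measurable_EFinP; exact: measurable_indic.
rewrite integral_indic // setIT; apply: lte_mul_pinfty => //.
by rewrite lee_fin powR_ge0.
Qed.

Lemma Lnorm_fatou (a : nat -> T -> R) b e N : (forall n, measurable_fun setT (a n)) ->
  (forall n x, 0 <= a n x) -> (forall x, a ^~ x @ \oo --> b x) -> 0 <= e ->
  (forall n, (N <= n)%N -> (Lnorm mu p%:E (fun x => (a n x)%:E) <= e%:E)%E) ->
  (Lnorm mu p%:E (fun x => (b x)%:E) <= e%:E)%E.
Proof.
move=> ma a0 ab e0 aN.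
have b0 x : 0 <= b x.
  rewrite -(cvg_lim (@Rhausdorff R) (ab x)).
  by apply: limr_ge; [exact: cvgP (ab x)|exact: nearW].
apply/Lnorm_leP => //.
(* Shifting by [N] makes every term satisfy the bound. *)
pose f n x : \bar R := (a (n + N)%N x `^ p)%:E.
have f0 n x : setT x -> (0 <= f n x)%E by move=> _; rewrite lee_fin powR_ge0.
have mf n : measurable_fun setT (f n) by exact: measurable_powRE.
have fb x : limn_einf (f ^~ x) = (b x `^ p)%:E.
  have : f ^~ x @ \oo --> (b x `^ p)%:E.
    apply: cvg_EFin; first exact: nearW.
    apply: (@cvg_powR _ _ (fun n => a (n + N)%N x)) => //.
    by rewrite (@cvg_shiftn N _ (a ^~ x)); exact: ab.
  by move=> /cvg_limn_einf_sup [].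
have := fatou mu measurableT mf f0.
under eq_integral do rewrite fb.
move=> h; apply: le_trans h _; rewrite limn_einf_lim.
apply: lime_le; first exact: is_cvg_einfs.
apply: nearW => n; apply: (@le_trans _ _ (\int[mu]_x f n x)%E).
  by apply: ereal_inf_lbound; exists n => /=.
by have /Lnorm_leP := aN (n + N)%N (leq_addl _ _); apply.
Qed.

(** Dominated convergence for [p]-th powers, with majorant [b ^ p], integrable because [b] has
    finite norm. *)
Lemma Lnorm_dominated (a : nat -> T -> R) b : (forall n, measurable_fun setT (a n)) ->
  measurable_fun setT b -> (forall n x, 0 <= a n x <= b x) ->
  (forall x, a ^~ x @ \oo --> (0 : R)) -> (Lnorm mu p%:E (fun x => (b x)%:E) < +oo)%E ->
  forall e, 0 < e -> \forall n \near \oo, (Lnorm mu p%:E (fun x => (a n x)%:E) <= e%:E)%E.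
Proof.
move=> ma mb ab a0 boo e e0.
have an0 n x : 0 <= a n x by have /andP[] := ab n x.
have b0 x : 0 <= b x by have /andP[h1 h2] := ab 0%N x; exact: le_trans h2.
have bint : mu.-integrable setT (fun x => (b x `^ p)%:E).
  apply/integrableP; split; first exact: measurable_powRE.
  under eq_integral do rewrite gee0_abs ?lee_fin ?powR_ge0 //.
  by rewrite -Lnorm_nneg_pow //; exact: poweR_lty.
have [//|//|_ _] := @dominated_convergence _ _ _ mu setT measurableT
  (fun n x => (a n x `^ p)%:E) (cst 0%E) (fun x => (b x `^ p)%:E)
  (fun n => measurable_powRE (ma n)) (measurable_cst _) _ bint _.
- apply: aeW => x _; apply: cvg_EFin; first exact: nearW.
  by rewrite -(powR0 (lt0r_neq0 p0)); apply: cvg_powR => // n; exact: a0.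
- apply: aeW => x n _; rewrite gee0_abs ?lee_fin ?powR_ge0 //.
  have /andP[_ h] := ab n x.
  by apply: ge0_ler_powR; rewrite ?nnegrE // ltW.
rewrite integral0 => cv.
have ep : (0 < (e `^ p)%:E)%E by rewrite lte_fin powR_gt0.
have : \forall n \near \oo, (\int[mu]_x (a n x `^ p)%:E < (e `^ p)%:E)%E.
  apply: (cv [set y | (y < (e `^ p)%:E)%E]); apply: open_nbhs_nbhs; split => //.
  exact: open_ereal_lt_ereal.
by apply: filterS => n /ltW h; apply/Lnorm_leP => //; exact: ltW.
Qed.

End nonnegative_Lnorm.

(** * The Segal algebra *)


Section Lp_norm_continuous.
Variables (R : realType) (T : topologicalZmodType).
Variable mu : {measure set (Borel T) -> \bar R}.
Variable p : R.
Hypothesis p1 : 1 <= p.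
Implicit Types (f w : T -> R[i]).

Lemma open_measurable_Borel (A : set T) : open A -> measurable (A : set (Borel T)).
Proof. by move=> oA; exact: sub_sigma_algebra. Qed.

Lemma measurable_cabs f : ccontinuous f ->
  measurable_fun [set: Borel T] (fun x : Borel T => cabs (f x)).
Proof.
move=> /ccontinuous_cabs/continuousP fc.
apply: (measurability _ (RGenOpens.measurableE R)).
move=> _ [_ [a [b ->] <-]]; rewrite setTI; apply: open_measurable_Borel.
exact/fc/interval_open.
Qed.

Lemma Lp_norm_ge0 f : (0 <= Lp_norm mu p f)%E. Proof. exact: Lnorm_ge0. Qed.

Lemma eq_Lp_norm f w : (forall x, cabs (f x) = cabs (w x)) -> Lp_norm mu p f = Lp_norm mu p w.
Proof. by move=> fw; apply: eq_Lnorm => x; rewrite fw. Qed.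

Lemma Lp_norm_bound f w (c : R) : ccontinuous f -> ccontinuous w -> 0 <= c ->
  (forall x, cabs (f x) <= c * cabs (w x)) ->
  (Lp_norm mu p f <= c%:E * Lp_norm mu p w)%E.
Proof.
move=> fc wc c0 fw; rewrite /Lp_norm -LnormZ_nneg //; last 2 first.
- exact: measurable_cabs.
- by move=> x; exact: cabs_ge0.
apply: le_Lnorm => //; first exact: measurable_cabs.
- by apply: measurable_funM; [exact: measurable_cst|exact: measurable_cabs].
- by move=> x; rewrite cabs_ge0 fw.
Qed.

Lemma Lp_normZ f (a : R[i]) : ccontinuous f ->
  Lp_norm mu p (fscale a f) = ((cabs a)%:E * Lp_norm mu p f)%E.
Proof.
move=> fc; rewrite /Lp_norm -LnormZ_nneg ?cabs_ge0 //.
- by apply: eq_Lnorm => x; rewrite /fscale cabsM.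
- exact: measurable_cabs.
- by move=> x; exact: cabs_ge0.
Qed.

Lemma Lp_normD f w : ccontinuous f -> ccontinuous w ->
  (Lp_norm mu p (fadd f w) <= Lp_norm mu p f + Lp_norm mu p w)%E.
Proof.
move=> fc wc; have mf := measurable_cabs fc; have mw := measurable_cabs wc.
apply: le_trans (minkowski_EFin mu mf mw p1).
apply: (@le_Lnorm _ _ _ mu p p1 _ (fun x => cabs (f x) + cabs (w x))).
- by apply: measurable_cabs; exact: ccontinuousD.
- exact: measurable_funD.
- by move=> x; rewrite cabs_ge0 cabsD.
Qed.

Lemma Lp_normB f w : ccontinuous f -> ccontinuous w ->
  (Lp_norm mu p (fsub f w) <= Lp_norm mu p f + Lp_norm mu p w)%E.
Proof.
move=> fc wc; have wc' : ccontinuous (fscale (-1) w).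
  by apply: (@ccontinuousM _ _ (fun=> -1) w) => //; exact: ccontinuous_cst.
have := Lp_normD fc wc'; rewrite Lp_normZ // cabsN cabs1 mul1e.
congr (_ <= _)%E; apply: eq_Lp_norm => x.
by rewrite /fadd /fscale /fsub mulN1r.
Qed.

Lemma Lp_norm_compact_support f (M : R) (D : set T) : hausdorff_space T ->
  (mu D < +oo)%E -> compact D -> ccontinuous f -> (forall x, cabs (f x) <= M) ->
  (forall x, ~ D x -> f x = 0) -> (Lp_norm mu p f < +oo)%E.
Proof.
move=> hT muD cD fc fM fD.
(* In a Hausdorff space a compact set is closed, hence Borel. *)
have mD : measurable (D : set (Borel T)).
  rewrite -[D]setCK; apply: measurableC; apply: open_measurable_Borel.
  by apply: closed_openC; exact: compact_closed.
apply: (@Lnorm_bounded_lty _ _ _ mu p p1 _ M D) => //.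
- exact: measurable_cabs.
- by move=> x; rewrite cabs_ge0 fM.
- by move=> x nDx; rewrite fD // cabs0.
Qed.

Lemma Lp_norm_fatou (u : nat -> T -> R[i]) f e N : (forall n, ccontinuous (u n)) ->
  (forall x d, 0 < d -> exists n0, forall n, (n0 <= n)%N -> cabs (u n x - f x) < d) ->
  0 <= e -> (forall n, (N <= n)%N -> (Lp_norm mu p (u n) <= e%:E)%E) ->
  (Lp_norm mu p f <= e%:E)%E.
Proof.
move=> uc uf e0; apply: Lnorm_fatou => //.
- by move=> n; exact: measurable_cabs.
- by move=> n x; exact: cabs_ge0.
- move=> x; apply/cvgrPdist_lt => d /(uf x) [n0 hn0]; exists n0 => // n /= nn.
  by rewrite distrC; apply: le_lt_trans (cabs_distD _ _) _; exact: hn0.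
Qed.

End Lp_norm_continuous.

Section bse_norm_axioms.
Variables (R : realType) (G Gamma : topologicalZmodType) (chi : G -> Gamma -> R[i]).
Hypothesis dual : is_dual_pairing chi.
Variable V : set Gamma.
Implicit Types (f w : Gamma -> R[i]).

Lemma A_alg_ltey f : A_alg chi V f -> (bse_norm chi V f < +oo)%E.
Proof. by move=> [[]]. Qed.

Lemma A_alg_continuous f : A_alg chi V f -> ccontinuous f.
Proof. by move=> [[[]]]. Qed.

Lemma bse_normD f w : (bse_norm chi V f < +oo)%E -> (bse_norm chi V w < +oo)%E ->
  (bse_norm chi V (fadd f w) <= bse_norm chi V f + bse_norm chi V w)%E.
Proof.
move=> fo wo; rewrite -(fineK (bse_norm_fin fo)) -(fineK (bse_norm_fin wo)) -EFinD.
by apply/bse_norm_leP; apply: unif_boundD; exact: unif_bound_fine.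
Qed.

Lemma bse_normM f w : (bse_norm chi V f < +oo)%E -> (bse_norm chi V w < +oo)%E ->
  (bse_norm chi V (fmul f w) <= bse_norm chi V f * bse_norm chi V w)%E.
Proof.
move=> fo wo; rewrite -(fineK (bse_norm_fin fo)) -(fineK (bse_norm_fin wo)) -EFinM.
by apply/bse_norm_leP; apply: unif_boundM => //; exact: unif_bound_fine.
Qed.

Lemma bse_normZ (a : R[i]) f : (bse_norm chi V f < +oo)%E ->
  bse_norm chi V (fscale a f) = ((cabs a)%:E * bse_norm chi V f)%E.
Proof.
have le_Z b w : (bse_norm chi V w < +oo)%E ->
    (bse_norm chi V (fscale b w) <= (cabs b)%:E * bse_norm chi V w)%E.
  move=> wo; rewrite -(fineK (bse_norm_fin wo)) -EFinM.
  by apply/bse_norm_leP; apply: unif_boundZ; exact: unif_bound_fine.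
move=> fo; apply/eqP; rewrite eq_le le_Z //=.
have [->|a0] := eqVneq a 0; first by rewrite cabs0 mul0e bse_norm_ge0.
have ao : (bse_norm chi V (fscale a f) < +oo)%E.
  by apply: le_lt_trans (le_Z a f fo) _; rewrite lte_mul_pinfty ?lee_fin ?cabs_ge0.
(* The reverse inequality is the first one, applied to [a^-1] and [fscale a f]. *)
have := le_Z a^-1 _ ao.
rewrite (_ : fscale a^-1 _ = f); last first.
  by apply/funext => g; rewrite /fscale mulKf.
move=> h; apply: le_trans (lee_wpmul2l _ h) _; first by rewrite lee_fin cabs_ge0.
by rewrite muleA -EFinM -cabsM mulfV // cabs1 mul1e.
Qed.

End bse_norm_axioms.

Theorem theorem6p2 (R : realType) (G Gamma : topologicalZmodType)
  (chi : G -> Gamma -> R[i]) (V : set Gamma)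
  (mu : {measure set (Borel Gamma) -> \bar R}) (p : R) :
  nondiscrete_LCA G ->
  is_dual_pairing chi ->
  open V -> V 0 -> compact (closure V) ->
  radon mu -> mu [set: Borel Gamma] = +oo%E ->
  1 <= p ->
  segal_algebra (A_alg chi V) (bse_norm chi V)
    [set psi | A_alg chi V psi /\ (Lp_norm mu p psi < +oo)%E]
    (fun psi => (bse_norm chi V psi + Lp_norm mu p psi)%E).
Proof.
move=> _ dual oV V0 cV [muK _ _] _ p1.
have hT := dual_hausdorff dual.
(* A Radon measure is finite on compact sets, so compactly supported members of the algebra lie in
   L^p. *)
have Lp_compact u (M : R) D : A_alg chi V u -> unif_bound chi V u M -> compact D ->
    (forall g, ~ D g -> u g = 0) -> (Lp_norm mu p u < +oo)%E.
  move=> uA uM cD uD; apply: (Lp_norm_compact_support p1 hT (muK _ cD) cD _ _ uD).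
    exact: A_alg_continuous uA.
  by move=> g; apply: (unif_bound_ge dual V0); exact: uM.
(* The norm of [h] dominates its values, so [|f h|] is at most that norm times [|f|]. *)
have LpM f h : A_alg chi V f -> A_alg chi V h ->
    (Lp_norm mu p (fmul f h) <= Lp_norm mu p f * bse_norm chi V h)%E.
  move=> fA hA; have fc := A_alg_continuous fA; have hc := A_alg_continuous hA.
  have hb := unif_bound_fine (A_alg_ltey hA).
  rewrite -[bse_norm chi V h]fineK ?bse_norm_fin ?A_alg_ltey // muleC.
  apply: Lp_norm_bound => //; first exact: ccontinuousM.
    exact: (unif_bound_ge0 dual V0 hb).
  move=> x; rewrite /fmul cabsM mulrC ler_wpM2r ?cabs_ge0 //.
  exact: (unif_bound_ge dual V0).
have AM f h : A_alg chi V f -> A_alg chi V h -> A_alg chi V (fmul f h).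
  move=> fA hA; apply: (A_algM dual V0 fA (A_alg_continuous hA)).
  exact: unif_bound_fine (A_alg_ltey hA).
have [C C0 hC] := A_alg_approximate_units dual oV V0 cV.
split.
- split.
  + by move=> f [].
  + move=> f1 f2 [A1 L1] [A2 L2]; split; first exact: A_algD.
    apply: le_lt_trans (Lp_normD _ p1 (A_alg_continuous A1) (A_alg_continuous A2)) _.
    exact: lte_add_pinfty.
  + move=> a f [fA fL]; split; first exact: A_algZ.
    rewrite Lp_normZ //; last exact: A_alg_continuous fA.
    by rewrite lte_mul_pinfty ?lee_fin ?cabs_ge0.
  + move=> f h [fA fL] hA; split; first exact: AM.
    apply: le_lt_trans (LpM _ _ fA hA) _; rewrite muleC.
    by rewrite lte_mul_pinfty ?bse_norm_ge0 ?bse_norm_fin ?A_alg_ltey.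
(* Density: the approximants [u h] have compact support and hence lie in L^p. *)
- move=> h hA e e0; have e2 : 0 < e / 2 by rewrite divr_gt0.
  have [u [uA uC [D cD uD] hu]] := hC h hA _ e2.
  have uhA : A_alg chi V (fmul u h) by exact: AM.
  exists (fmul u h).
    split => //; apply: (Lp_compact _ _ D uhA (unif_bound_fine (A_alg_ltey uhA)) cD).
    by move=> g /uD; rewrite /fmul => ->; rewrite mul0r.
  move/bse_norm_leP : hu => hu; apply: le_lt_trans hu _.
  by rewrite lte_fin ltr_pdivrMr // ltr_pMr // ltr1n.
- split.
  + move=> f [fA fL]; rewrite fin_numD bse_norm_fin ?A_alg_ltey //=.
    by rewrite ge0_fin_numE ?Lp_norm_ge0.
  + move=> f [fA fL] /eqP; rewrite padde_eq0 ?bse_norm_ge0 ?Lp_norm_ge0 //.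
    move=> /andP[/eqP f0 _]; have /bse_norm_leP fb : (bse_norm chi V f <= 0%:E)%E by rewrite f0.
    apply/funext => g; apply: cabs_eq0; apply/le_anti.
    by rewrite cabs_ge0 (unif_bound_ge dual V0 _ fb).
  + move=> a f [fA fL]; rewrite bse_normZ ?A_alg_ltey //.
    rewrite Lp_normZ //; last exact: A_alg_continuous fA.
    by rewrite ge0_muleDr ?bse_norm_ge0 ?Lp_norm_ge0.
  + move=> f1 f2 [A1 L1] [A2 L2]; rewrite addeACA; apply: leeD.
      by apply: bse_normD; exact: A_alg_ltey.
    exact: (Lp_normD mu p1 (A_alg_continuous A1) (A_alg_continuous A2)).
  + move=> u uS hu.
    have uA n : A_alg chi V (u n) by have [] := uS n.
    have uc n : ccontinuous (u n) := A_alg_continuous (uA n).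
    have uBc m n : ccontinuous (fsub (u m) (u n)).
      by apply: (@A_alg_continuous _ _ _ chi V); exact: A_algB.
    have [f [fA uf hf]] : exists f, [/\ A_alg chi V f,
        forall g e, 0 < e -> exists n0, forall n, (n0 <= n)%N -> cabs (u n g - f g) < e &
        forall e, 0 < e -> exists n0, forall n, (n0 <= n)%N ->
          unif_bound chi V (fsub (u n) f) e].
      apply: A_alg_complete => // e /hu [n0 hn0]; exists n0 => m n nm nn.
      apply/bse_norm_leP; apply: le_trans (ltW (hn0 m n nm nn)).
      by rewrite leeDl // Lp_norm_ge0.
    have fc := A_alg_continuous fA.
    (* Fatou's lemma, for [n] fixed and [m] tending to infinity, turns the Cauchy estimate into an
       L^p bound for [u n - f]. *)
    have uLf e : 0 < e -> exists n0, forall n, (n0 <= n)%N ->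
        (Lp_norm mu p (fsub (u n) f) <= e%:E)%E.
      move=> e0; have [n0 hn0] := hu e e0; exists n0 => n nn.
      apply: (@Lp_norm_fatou _ _ _ _ p1 (fun m => fsub (u n) (u m)) _ _ n0) => //.
      * move=> x d /(uf x) [n1 hn1]; exists n1 => m /hn1.
        rewrite /fsub (_ : _ - _ - _ = - (u m x - f x)) ?cabsN //; by ring.
      * exact: ltW.
      * move=> m nm; apply: le_trans (ltW (hn0 n m nn nm)).
        by rewrite leeDr // bse_norm_ge0.
    exists f.
      split => //; have [n0 /(_ n0 (leqnn _)) hn0] := uLf 1 ltr01.
      have ufc : ccontinuous (fsub (u n0) f).
        by apply: (@A_alg_continuous _ _ _ chi V); exact: A_algB.
      have -> : f = fsub (u n0) (fsub (u n0) f).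
        by apply/funext => x; rewrite /fsub; ring.
      apply: le_lt_trans (Lp_normB _ p1 (uc n0) ufc) _.
      apply: lte_add_pinfty; first by have [] := uS n0.
      by apply: le_lt_trans hn0 _; exact: ltry.
    (* Both estimates below are nonstrict; two thirds of [e] keep their sum strictly below [e]. *)
    move=> e e0; have e3 : 0 < e / 3 by rewrite divr_gt0.
    have [n1 hn1] := uLf _ e3; have [n2 hn2] := hf _ e3.
    exists (maxn n1 n2) => n; rewrite geq_max => /andP[/hn1 h1 /hn2 /bse_norm_leP h2].
    apply: le_lt_trans (leeD h2 h1) _; rewrite -EFinD lte_fin.
    by lra.
- split.
  + by move=> f [fA fL]; rewrite leeDl // Lp_norm_ge0.
  + move=> f h [fA fL] hA; rewrite ge0_muleDl ?bse_norm_ge0 ?Lp_norm_ge0 //.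
    apply: leeD; last exact: LpM.
    by apply: bse_normM => //; exact: A_alg_ltey.
- move=> f [fA fL] e e0; have e3 : 0 < e / 3 by rewrite divr_gt0.
  have fc := A_alg_continuous fA.
  have n0 (n : nat) : 0 < n.+1%:R^-1 :> R by rewrite invr_gt0.
  (* All [u n] are bounded by the same [C], so [(1 + C) |f|] dominates every [f - u n f]. These tend
     to 0 pointwise because their norms are at most [1 / (n + 1)]. *)
  have /choice [u hu] := fun n => hC f fA _ (n0 n).
  have uA n : A_alg chi V (u n) by have [] := hu n.
  pose w n := fsub f (fmul (u n) f).
  have wA n : A_alg chi V (w n) by apply: A_algB => //; exact: AM.
  have wn n : unif_bound chi V (w n) n.+1%:R^-1 by have [] := hu n.
  have cv0 : (fun n => n.+1%:R^-1 : R) @ \oo --> (0 : R) by exact: cvg_harmonic.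
  have Lw := @Lnorm_dominated _ _ _ mu p p1 (fun n x => cabs (w n x))
    (fun x => (1 + C) * cabs (f x)).
  have C1 : 0 <= 1 + C by rewrite addr_ge0.
  have mf := measurable_cabs fc.
  have {}Lw : \forall n \near \oo, (Lp_norm mu p (w n) <= (e / 3)%:E)%E.
    apply: Lw => //.
    + by move=> n; apply: measurable_cabs; exact: A_alg_continuous (wA n).
    + by apply: measurable_funM.
    + move=> n x; rewrite cabs_ge0 /=; have [_ uC _ _] := hu n.
      rewrite /w /fsub /fmul -[X in cabs (X - _)]mul1r -mulrBl cabsM.
      rewrite ler_wpM2r ?cabs_ge0 //; apply: le_trans (cabsD _ _) _.
      by rewrite cabs1 cabsN lerD2l; exact: (unif_bound_ge dual V0).
    + move=> x; apply: (@squeeze_cvgr _ _ _ _ (fun=> 0) (fun n => n.+1%:R^-1)) => //.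
        by apply: nearW => n; rewrite cabs_ge0 (unif_bound_ge dual V0 _ (wn n)).
      exact: cvg_cst.
    + rewrite LnormZ_nneg // => [|x]; last exact: cabs_ge0.
      by rewrite lte_mul_pinfty.
  have : \forall n \near \oo, n.+1%:R^-1 < e / 3 by exact: (cv0 _ (lt_nbhsl e3)).
  move=> /(filterI Lw) [N _ /(_ N (leqnn N)) /= [h1 h2]].
  have [_ uC [D cD uD] _] := hu N.
  exists (u N); first by split => //; exact: Lp_compact uC cD uD.
  have /bse_norm_leP h3 := wn N.
  apply: le_lt_trans (leeD h3 h1) _; rewrite -EFinD lte_fin.
  apply: (@lt_trans _ _ (e / 3 + e / 3)); first by rewrite ltrD2r.
  by lra.
Qed.
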